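(* Let $2\leq p<\infty$ be an integer. The isometries $(\sigma(T_i))_{0\leq i\leq p-1}$ are pure and the representation $\sigma$ of $\mathcal{O}_p$ on $L^2([0,1])$ extends uniquely to a representation $\widetilde{\sigma}\colon\mathcal{Q}_p\to\mathcal{L}(L^2([0,1]))$. Moreover, $\widetilde{\sigma}$ is not unitarily equivalent to the canonical representation $\pi\colon\mathcal{Q}_p\to\mathcal{L}(\ell^2(\mathbb{Z}))$.
   Context: For an integer $2\leq p<\infty$, the $p$-adic ring $C^*$-algebra $\mathcal{Q}_p$ is the universal $C^*$-algebra generated by a unitary $u$ and an isometry $s_p$ subject to $s_pu=u^ps_p$ and $\sum_{i=0}^{p-1}u^is_ps_p^*u^{-i}=1$. The isometries $T_i=u^is_p$, $0\leq i\leq p-1$, generate a copy of the Cuntz algebra $\mathcal{O}_p$ inside $\mathcal{Q}_p$. The interval picture $\sigma\colon\mathcal{O}_p\to\mathcal{L}(L^2([0,1]))$ (Lebesgue measure) is the representation given by $\sigma(T_i)(f)(t)=\sqrt{p}\,f(h_i^{-1}(t))$ for $t\in[i/p,(i+1)/p]$ and $\sigma(T_i)(f)(t)=0$ otherwise, where $h_i\colon[0,1]\to[i/p,(i+1)/p]$, $h_i(t)=(i+t)/p$. The canonical representation $\pi$ is given by $\pi(u)\xi_m=\xi_{m+1}$ and $\pi(s_p)\xi_m=\xi_{pm}$ on the standard orthonormal basis $(\xi_m)_{m\in\mathbb{Z}}$ of $\ell^2(\mathbb{Z})$. An isometry is called pure if the range projections of its powers converge strongly to $0$. *)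

(* Defs.v *)
From HB Require Import structures.
From mathcomp Require Import all_boot all_order all_algebra.
From mathcomp Require Import generic_quotient ring_quotient complex.
From mathcomp Require Import all_classical all_reals all_analysis.
From mathcomp Require Import measurable_realfun ring lra.

Set Implicit Arguments.
Unset Strict Implicit.
Unset Printing Implicit Defensive.

Import Order.TTheory GRing.Theory Num.Theory.
Import numFieldNormedType.Exports.
Import Normc.

Local Open Scope classical_set_scope.
Local Open Scope ring_scope.

HB.mixin Record NormedModule_hasInner (R : realType) H
    & NormedModule R[i] H := {
  inner : H -> H -> R[i];
  innerDl : forall x y z : H, inner (x + y) z = inner x z + inner y z;
  innerZl : forall (a : R[i]) (x y : H), inner (a *: x) y = a * inner x y;
  innerC : forall x y : H, inner y x = (inner x y)^*;
  inner_normE : forall x : H, inner x x = `|x| ^+ 2 }.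

#[short(type="preHilbertType")]
HB.structure Definition PreHilbert (R : realType) :=
  {H of NormedModule R[i] H & NormedModule_hasInner R H}.

HB.factory Record Lmodule_hasInner (R : realType) H & GRing.Lmodule R[i] H := {
  inner : H -> H -> R[i];
  innerDl : forall x y z : H, inner (x + y) z = inner x z + inner y z;
  innerZl : forall (a : R[i]) (x y : H), inner (a *: x) y = a * inner x y;
  innerC : forall x y : H, inner y x = (inner x y)^*;
  inner_gt0 : forall x : H, x != 0 -> 0 < inner x x }.

HB.builders Context R H & Lmodule_hasInner R H.

Let norm (x : H) : R[i] := sqrtC (inner x x).

Let innerDr x y z : inner x (y + z) = inner x y + inner x z.
Proof. by rewrite innerC innerDl rmorphD/= -!innerC. Qed.

Let innerZr a x y : inner x (a *: y) = a^* * inner x y.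
Proof. by rewrite innerC innerZl rmorphM/= -innerC. Qed.

Let inner0l x : inner 0 x = 0.
Proof. by rewrite -(scale0r (0 : H)) innerZl mul0r. Qed.

Let inner_ge0 x : 0 <= inner x x.
Proof. by have [->|/inner_gt0/ltW//] := eqVneq x 0; rewrite inner0l. Qed.

Let inner_eq0 x : inner x x = 0 -> x = 0.
Proof.
by move=> x0; apply/eqP/negPn/negP => /inner_gt0; rewrite x0 ltxx.
Qed.

Let CS x y : `|inner x y| ^+ 2 <= inner x x * inner y y.
Proof.
have [->|y0] := eqVneq y 0.
  by rewrite inner0l mulr0 innerC inner0l rmorph0 normr0 expr0n.
have ypos := inner_gt0 y0.
set d := inner y y; set c := inner x y.
have := inner_ge0 (d *: x - c *: y).
have -> : inner (d *: x - c *: y) (d *: x - c *: y)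
    = d * (inner x x * d - `|c| ^+ 2).
  rewrite -scaleNr !innerDl !innerDr !innerZl !innerZr.
  have dR : d^* = d by rewrite /d -innerC.
  rewrite rmorphN/= dR (innerC x y) -/c -/d normCK.
  ring.
by rewrite pmulr_rge0// subr_ge0.
Qed.

Let ler_normD x y : norm (x + y) <= norm x + norm y.
Proof.
rewrite -(ler_pXn2r (n := 2))// ?nnegrE ?addr_ge0 ?sqrtC_ge0//.
rewrite /norm sqrtCK sqrrD !sqrtCK innerDl !innerDr.
rewrite -!addrA lerD2l !addrA lerD2r.
rewrite (innerC x y).
have := CS x y; rewrite -[leRHS]sqrtCK ler_pXn2r ?nnegrE ?normr_ge0//; last first.
  by rewrite sqrtC_ge0 mulr_ge0.
rewrite sqrtCM ?nnegrE// => CSxy.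
have CR : inner x y + Num.conj (inner x y) <= `|inner x y| *+ 2.
  have := leif_Re_Creal (inner x y); rewrite ReE => -[+ _].
  by rewrite ler_pdivrMr// mulr_natr.
by apply: le_trans CR _; rewrite lerMn2r CSxy orbT.
Qed.

Let normrZ (l : R[i]) x : norm (l *: x) = `|l| * norm x.
Proof.
rewrite /norm innerZl innerZr mulrA -normCK sqrtCM ?nnegrE ?exprn_ge0//.
by rewrite sqrCK.
Qed.

Let normr0_eq0 x : norm x = 0 -> x = 0.
Proof. by move/eqP; rewrite sqrtC_eq0 => /eqP/inner_eq0. Qed.

HB.instance Definition _ :=
  @Lmodule_isNormed.Build R[i] H norm ler_normD normrZ normr0_eq0.

Let inner_normE (x : H) : inner x x = `|x| ^+ 2.
Proof. by rewrite [`|x|]/(norm x) sqrtCK. Qed.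

HB.instance Definition _ :=
  NormedModule_hasInner.Build R H innerDl innerZl innerC inner_normE.

HB.end.

HB.mixin Record isStarAlgebra (R : realType) A & GRing.Algebra R[i] A := {
  star : A -> A;
  starK : involutive star;
  starD : forall a b : A, star (a + b) = star a + star b;
  starZ : forall (c : R[i]) (a : A), star (c *: a) = c^* *: star a;
  starM : forall a b : A, star (a * b) = star b * star a }.

#[short(type="starAlgType")]
HB.structure Definition StarAlgebra (R : realType) :=
  {A of GRing.Algebra R[i] A & isStarAlgebra R A}.

(* The norm cannot be the one of [normedModType]: Hierarchy Builder has no
   room for a join of the algebra and normed module structures. *)
HB.mixin Record StarAlgebra_isCStarAlgebra (R : realType) A
    & StarAlgebra R A := {
  cnorm : A -> R;
  cnorm0_eq0 : forall a : A, cnorm a = 0 -> a = 0;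
  ler_cnormD : forall a b : A, cnorm (a + b) <= cnorm a + cnorm b;
  cnormZ : forall (c : R[i]) (a : A), cnorm (c *: a) = normc c * cnorm a;
  ler_cnormM : forall a b : A, cnorm (a * b) <= cnorm a * cnorm b;
  cnorm_starM : forall a : A, cnorm (star a * a) = cnorm a ^+ 2;
  cnorm_complete : forall x : nat -> A,
    (forall e, 0 < e -> exists N, forall m n, (N <= m)%N -> (N <= n)%N ->
      cnorm (x m - x n) < e) ->
    exists a, cnorm (x n - a) @[n --> \oo] --> (0 : R) }.

#[short(type="cstarAlgType")]
HB.structure Definition CStarAlgebra (R : realType) :=
  {A of StarAlgebra R A & StarAlgebra_isCStarAlgebra R A}.

HB.mixin Record PreHilbert_isNontrivial (R : realType) H & PreHilbert R H := {
  exists_neq0 : exists x : H, x != 0 }.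

#[short(type="nzPreHilbertType")]
HB.structure Definition NzPreHilbert (R : realType) :=
  {H of PreHilbert R H & PreHilbert_isNontrivial R H}.

#[short(type="hilbertType")]
HB.structure Definition Hilbert (R : realType) :=
  {H of NzPreHilbert R H & Complete H}.

Section PreHilbertTheory.
Context {R : realType} {H : preHilbertType R}.
Implicit Types x y z : H.

Lemma innerDr x y z : inner x (y + z) = inner x y + inner x z.
Proof. by rewrite innerC innerDl rmorphD/= -!innerC. Qed.

Lemma innerZr (a : R[i]) x y : inner x (a *: y) = a^* * inner x y.
Proof. by rewrite innerC innerZl rmorphM/= -innerC. Qed.

Lemma inner0l x : inner 0 x = 0.
Proof. by rewrite -(scale0r (0 : H)) innerZl mul0r. Qed.

Lemma inner0r x : inner x 0 = 0.
Proof. by rewrite innerC inner0l rmorph0. Qed.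

Lemma inner_extl x y : (forall z, inner x z = inner y z) -> x = y.
Proof.
move=> xy; apply/eqP; rewrite -subr_eq0 -normr_eq0 -sqrf_eq0 -inner_normE.
by rewrite -scaleN1r innerDl innerZl -xy mulN1r subrr.
Qed.

Lemma inner_extr x y : (forall z, inner z x = inner z y) -> x = y.
Proof. by move=> xy; apply: inner_extl => z; rewrite innerC xy -innerC. Qed.

Lemma ler_norm_inner x y : `|inner x y| <= `|x| * `|y|.
Proof.
have [->|y0] := eqVneq y 0.
  by rewrite inner0r normr0 mulr_ge0.
rewrite -(ler_pXn2r (n := 2))// ?nnegrE ?mulr_ge0// exprMn -!inner_normE.
have ypos : 0 < inner y y by rewrite inner_normE exprn_gt0// normr_gt0.
set d := inner y y; set c := inner x y.
have : 0 <= inner (d *: x - c *: y) (d *: x - c *: y).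
  by rewrite inner_normE exprn_ge0.
have -> : inner (d *: x - c *: y) (d *: x - c *: y)
    = d * (inner x x * d - `|c| ^+ 2).
  rewrite -scaleNr !innerDl !innerDr !innerZl !innerZr.
  have dR : d^* = d by rewrite /d -innerC.
  by rewrite rmorphN/= dR (innerC x y) -/c -/d normCK; ring.
by rewrite pmulr_rge0// subr_ge0.
Qed.

End PreHilbertTheory.

Definition adjoint_pair {R : realType} {H : preHilbertType R} (f g : H -> H) :=
  forall x y, inner (f x) y = inner x (g y).

Section BoundedOperators.
Context {R : realType} {H : preHilbertType R}.

Definition bounded_op (f : H -> H) : Prop :=
  [/\ linear f, exists M : R[i], forall x, `|f x| <= M * `|x| &
      exists g, adjoint_pair f g].

Definition bounded_op_pred : {pred H -> H} := fun f => `[< bounded_op f >].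

Let bounded_op_submod_closed : submod_closed bounded_op_pred.
Proof.
split.
  apply/asboolP; split.
  - by move=> a x y /=; rewrite scaler0 addr0.
  - by exists 0 => x; rewrite normr0 mul0r.
  - by exists (fun=> 0) => x y; rewrite inner0r [LHS]inner0l.
move=> a f g /asboolP[lf [M fM] [f' ff']] /asboolP[lg [N gN] [g' gg']].
apply/asboolP; split.
- move=> b x y; rewrite /= !fctE lf lg !scalerDr !scalerA (mulrC b).
  by rewrite addrACA.
- exists (`|a| * M + N) => x; rewrite (le_trans (ler_normD _ _))//.
  by rewrite mulrDl lerD// normrZ -mulrA ler_wpM2l.
- exists (fun y => a^* *: f' y + g' y) => x y.
  by rewrite innerDl innerDr innerZl innerZr conjCK ff' gg'.
Qed.

HB.instance Definition _ :=
  GRing.isSubmodClosed.Build R[i] (H -> H) bounded_op_pred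
    bounded_op_submod_closed.

(* On a Hilbert space every bounded linear operator has an adjoint (Riesz), so
   that the last clause of [bounded_op] is then redundant. *)
Record bounded_operator := BoundedOperator { bounded_operator_fun :> H -> H;
                         bounded_operator_subproof : bounded_operator_fun \in bounded_op_pred }.

HB.instance Definition _ := [isSub for bounded_operator_fun].
HB.instance Definition _ := gen_eqMixin bounded_operator.
HB.instance Definition _ := [Choice of bounded_operator by <:].
HB.instance Definition _ := [SubChoice_isSubLmodule of bounded_operator by <:].

Lemma bounded_operatorP (f g : bounded_operator) : (forall x, f x = g x) -> f = g.
Proof. by move=> fg; apply: val_inj; apply/funext. Qed.

Lemma bounded_operator_bounded (f : bounded_operator) : bounded_op f.
Proof. exact/asboolP/bounded_operator_subproof. Qed.

Fact bounded_op_id : (id : H -> H) \in bounded_op_pred.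
Proof.
apply/asboolP; split=> //; first by exists 1 => x; rewrite mul1r.
by exists id.
Qed.

Fact bounded_op_comp (f g : bounded_operator) : f \o g \in bounded_op_pred.
Proof.
have [lf [M fM] [f' ff']] := bounded_operator_bounded f.
have [lg [N gN] [g' gg']] := bounded_operator_bounded g.
apply/asboolP; split.
- by move=> a x y; rewrite /= lg lf.
- exists (`|M| * N) => x; rewrite (le_trans (fM _))// -mulrA.
  rewrite (@le_trans _ _ (`|M| * `|g x|))// ?ler_wpM2l//.
  have [->|gx0] := eqVneq (g x) 0; first by rewrite !normr0 !mulr0.
  rewrite ler_wpM2r// ger0_norm//.
  rewrite -(@pmulr_lge0 _ (`|g x|)) ?normr_gt0//.
  exact: le_trans (fM _).
- by exists (g' \o f') => x y; rewrite ff' gg'.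
Qed.

Definition bounded_operator_adj (f : bounded_operator) : H -> H :=
  let: And3 _ _ fg := bounded_operator_bounded f in sval (cid fg).

Lemma bounded_operator_adjP (f : bounded_operator) : adjoint_pair f (bounded_operator_adj f).
Proof. by rewrite /bounded_operator_adj; case: bounded_operator_bounded => _ _ ?; case: cid. Qed.

Fact bounded_op_adj (f : bounded_operator) : bounded_operator_adj f \in bounded_op_pred.
Proof.
have [lf [M fM] _] := bounded_operator_bounded f.
have fP := bounded_operator_adjP f.
apply/asboolP; split.
- move=> a x y; apply: inner_extr => z.
  by rewrite -fP !innerDr !innerZr -!fP.
- exists M => y; set z := bounded_operator_adj f y.
  have [->|z0] := eqVneq z 0.
    have [->|y0] := eqVneq y 0; first by rewrite !normr0 mulr0.
    by rewrite normr0 (le_trans _ (fM y)).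
  have : `|z| ^+ 2 <= `|f z| * `|y|.
    by rewrite -inner_normE -fP (le_trans _ (ler_norm_inner _ _))//
      fP inner_normE ger0_norm ?exprn_ge0.
  move=> /le_trans/(_ (ler_wpM2r (normr_ge0 _) (fM z))).
  by rewrite expr2 mulrAC ler_pM2r// normr_gt0.
- by exists f => x y; rewrite innerC -fP -innerC.
Qed.

Definition bounded_operator_one := BoundedOperator bounded_op_id.
Definition bounded_operator_mul f g := BoundedOperator (bounded_op_comp f g).
Definition bounded_operator_star f := BoundedOperator (bounded_op_adj f).

Lemma bounded_operator_linear (f : bounded_operator) : linear f.
Proof. by case: (bounded_operator_bounded f). Qed.

Lemma bounded_operator_addE (f g : bounded_operator) x : (f + g) x = f x + g x.
Proof. by []. Qed.

Lemma bounded_operator_scaleE a (f : bounded_operator) x : (a *: f) x = a *: f x.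
Proof. by []. Qed.

End BoundedOperators.
Arguments bounded_operator {R} H.

Section BoundedOperatorStarAlgebra.
Context {R : realType} {H : nzPreHilbertType R}.

Local Notation bounded_operator_mul := (@bounded_operator_mul R H).
Local Notation bounded_operator_one := (@bounded_operator_one R H).
Local Notation bounded_operator_star := (@bounded_operator_star R H).
Local Notation bounded_operator := (bounded_operator H).

Let mulA : associative bounded_operator_mul.
Proof. by move=> f g h; exact: bounded_operatorP. Qed.
Let mul1 : left_id bounded_operator_one bounded_operator_mul.
Proof. by move=> f; exact: bounded_operatorP. Qed.
Let mulr1 : right_id bounded_operator_one bounded_operator_mul.
Proof. by move=> f; exact: bounded_operatorP. Qed.
Let mulDl : left_distributive bounded_operator_mul +%R.
Proof. by move=> f g h; exact: bounded_operatorP. Qed.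
Let mulDr : right_distributive bounded_operator_mul +%R.
Proof.
move=> f g h; apply: bounded_operatorP => x; rewrite bounded_operator_addE /=.
by have := bounded_operator_linear f 1 (g x) (h x); rewrite !scale1r.
Qed.

Let oner_neq0 : bounded_operator_one != 0.
Proof.
have [x x0] := @exists_neq0 R H; apply: contra x0 => /eqP one0.
by rewrite -[x]/(bounded_operator_one x) one0.
Qed.

HB.instance Definition _ :=
  GRing.Zmodule_isNzRing.Build bounded_operator mulA mul1 mulr1 mulDl mulDr oner_neq0.

Let scaleAl (c : R[i]) (f g : bounded_operator) : c *: (f * g) = (c *: f) * g.
Proof. exact: bounded_operatorP. Qed.
Let scaleAr (c : R[i]) (f g : bounded_operator) : c *: (f * g) = f * (c *: g).
Proof.
apply: bounded_operatorP => x; rewrite bounded_operator_scaleE /=.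
have := bounded_operator_linear f c (g x) 0; rewrite !addr0.
have -> : f 0 = 0 by have := bounded_operator_linear f (-1) 0 0; rewrite scaler0 addr0 scaleN1r addNr.
by rewrite addr0.
Qed.

HB.instance Definition _ :=
  GRing.Lmodule_isLalgebra.Build R[i] bounded_operator scaleAl.
HB.instance Definition _ :=
  GRing.Lalgebra_isAlgebra.Build R[i] bounded_operator scaleAr.

Let adjE (f : bounded_operator) : adjoint_pair f (bounded_operator_star f) := bounded_operator_adjP f.

Let bounded_operator_starK : involutive bounded_operator_star.
Proof.
move=> f; apply: bounded_operatorP => x; apply: inner_extr => z.
by rewrite -adjE innerC -adjE -innerC.
Qed.
Let starD (f g : bounded_operator) : bounded_operator_star (f + g) = bounded_operator_star f + bounded_operator_star g.
Proof.
apply: bounded_operatorP => x; apply: inner_extr => z.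
by rewrite -adjE !bounded_operator_addE innerDl innerDr -!adjE.
Qed.
Let starZ (c : R[i]) f : bounded_operator_star (c *: f) = c^* *: bounded_operator_star f.
Proof.
apply: bounded_operatorP => x; apply: inner_extr => z.
by rewrite -adjE !bounded_operator_scaleE innerZl innerZr conjCK -!adjE.
Qed.
Let starM (f g : bounded_operator) : bounded_operator_star (f * g) = bounded_operator_star g * bounded_operator_star f.
Proof.
apply: bounded_operatorP => x; apply: inner_extr => z.
by rewrite -[LHS]adjE [LHS](adjE f (g z)) [LHS](adjE g z).
Qed.

HB.instance Definition _ := isStarAlgebra.Build R bounded_operator
  bounded_operator_starK starD starZ starM.

End BoundedOperatorStarAlgebra.

Lemma bounded_operator_starP (R : realType) (H : nzPreHilbertType R) (f : bounded_operator H) x y :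
  inner (f x) y = inner x (star f y).
Proof. exact: bounded_operator_adjP. Qed.

Section SquareIntegrable.
Context d {T : measurableType d} {R : realType}.
Variable mu : {measure set T -> \bar R}.

Definition square_integrable (f : T -> R[i]^o) : Prop :=
  [/\ measurable_fun setT (fun x => complex.Re (f x)),
      measurable_fun setT (fun x => complex.Im (f x)) &
      (\int[mu]_x ((normc (f x)) ^+ 2)%:E < +oo)%E].

Definition square_integrable_pred : {pred T -> R[i]^o} :=
  fun f => `[< square_integrable f >].

Let normc2E (z : R[i]) : normc z ^+ 2 = complex.Re z ^+ 2 + complex.Im z ^+ 2.
Proof. by case: z => a b /=; rewrite sqr_sqrtr ?addr_ge0 ?sqr_ge0. Qed.

Let Re_lin (a z w : R[i]) : complex.Re (a * z + w) =
  complex.Re a * complex.Re z - complex.Im a * complex.Im z + complex.Re w.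
Proof. by case: a z w => [a b] [c e] [h k]. Qed.

Let Im_lin (a z w : R[i]) : complex.Im (a * z + w) =
  complex.Re a * complex.Im z + complex.Im a * complex.Re z + complex.Im w.
Proof. by case: a z w => [a b] [c e] [h k]. Qed.

Lemma measurable_normc2 (f : T -> R[i]) :
  measurable_fun setT (fun x => complex.Re (f x)) ->
  measurable_fun setT (fun x => complex.Im (f x)) ->
  measurable_fun setT (fun x => normc (f x) ^+ 2).
Proof.
move=> mr mi; under eq_fun do rewrite normc2E.
by apply: measurable_funD; exact: measurable_funX.
Qed.

Let square_integrable_submod_closed : submod_closed square_integrable_pred.
Proof.
split.
  apply/asboolP; split; [exact: measurable_cst|exact: measurable_cst|].
  under eq_integral do rewrite [X in normc X]/(0 : R[i]) normc0 expr0n/=.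
  by rewrite integral0 ltry.
move=> a f g /asboolP[fr fi f2] /asboolP[gr gi g2].
have RE x : complex.Re ((a *: f + g) x) = complex.Re a * complex.Re (f x)
    - complex.Im a * complex.Im (f x) + complex.Re (g x).
  exact: Re_lin.
have IE x : complex.Im ((a *: f + g) x) = complex.Re a * complex.Im (f x)
    + complex.Im a * complex.Re (f x) + complex.Im (g x).
  exact: Im_lin.
have mr : measurable_fun setT (fun x => complex.Re ((a *: f + g) x)).
  under eq_fun do rewrite RE.
  by apply: measurable_funD => //; apply: measurable_funB;
    apply: measurable_funM => //; exact: measurable_cst.
have mi : measurable_fun setT (fun x => complex.Im ((a *: f + g) x)).
  under eq_fun do rewrite IE.
  by apply: measurable_funD => //; apply: measurable_funD;
    apply: measurable_funM => //; exact: measurable_cst.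
have m2 (h : T -> R[i]) : measurable_fun setT (fun x => complex.Re (h x)) ->
    measurable_fun setT (fun x => complex.Im (h x)) ->
    measurable_fun setT (fun x => ((normc (h x)) ^+ 2)%:E).
  by move=> hr hi; apply/measurable_EFinP; exact: measurable_normc2.
apply/asboolP; split => //.
pose C := 2 * normc a ^+ 2.
have C0 : 0 <= C by rewrite mulr_ge0 ?sqr_ge0.
apply: (@le_lt_trans _ _ (\int[mu]_x
    (C%:E * ((normc (f x)) ^+ 2)%:E + 2%:E * ((normc (g x)) ^+ 2)%:E)))%E.
  apply: ge0_le_integral => //.
  - by move=> x _; rewrite lee_fin sqr_ge0.
  - exact: m2.
  - by apply: emeasurable_funD; apply: measurable_funeM; exact: m2.
  - move=> x _; rewrite lee_fin normc2E RE IE /C !normc2E.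
    move: (complex.Re a) (complex.Im a) (complex.Re (f x)) (complex.Im (f x))
      (complex.Re (g x)) (complex.Im (g x)) => a1 a2 f1 f2' g1 g2'.
    rewrite -subr_ge0.
    rewrite [leRHS](_ : _ = (a1 * f1 - a2 * f2' - g1) ^+ 2 +
                            (a1 * f2' + a2 * f1 - g2') ^+ 2); last by ring.
    by rewrite addr_ge0 ?sqr_ge0.
rewrite ge0_integralD//; last 4 first.
- by move=> x _; rewrite mule_ge0// lee_fin ?sqr_ge0.
- by apply: measurable_funeM; exact: m2.
- by move=> x _; rewrite mule_ge0// lee_fin ?sqr_ge0.
- by apply: measurable_funeM; exact: m2.
rewrite !ge0_integralZl//; [|exact: m2|by move=> x _; rewrite lee_fin sqr_ge0
  |exact: m2|by move=> x _; rewrite lee_fin sqr_ge0].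
by rewrite lte_add_pinfty// lte_mul_pinfty// ?lee_fin//
  integral_ge0// => x _; rewrite lee_fin sqr_ge0.
Qed.

HB.instance Definition _ :=
  GRing.isSubmodClosed.Build R[i] (T -> R[i]^o) square_integrable_pred
    square_integrable_submod_closed.

Record L2fun := L2Fun { L2fun_val :> T -> R[i]^o;
  L2fun_subproof : L2fun_val \in square_integrable_pred }.

HB.instance Definition _ := [isSub for L2fun_val].
HB.instance Definition _ := gen_eqMixin L2fun.
HB.instance Definition _ := [Choice of L2fun by <:].
HB.instance Definition _ := [SubChoice_isSubLmodule of L2fun by <:].

Lemma L2funP (f : L2fun) : square_integrable f.
Proof. exact/asboolP/L2fun_subproof. Qed.

Definition L2null : {pred L2fun} :=
  fun f => `[< {ae mu, forall x, f x = 0} >].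

Let L2null_zmod_closed : zmod_closed L2null.
Proof.
split; first by apply/asboolP; apply: aeW.
move=> f g /asboolP f0 /asboolP g0; apply/asboolP.
by apply: filterS2 f0 g0 => x f0 g0; rewrite -[LHS]/(f x - g x) f0 g0 subrr.
Qed.

HB.instance Definition _ :=
  GRing.isZmodClosed.Build L2fun L2null L2null_zmod_closed.

(* Square integrable complex functions modulo equality almost everywhere. *)
Definition L2 : Type := @Quotient.quot L2fun L2null.

HB.instance Definition _ := GRing.Zmodule.copy L2 (@Quotient.quot L2fun L2null).
HB.instance Definition _ := EqQuotient.copy L2 (@Quotient.quot L2fun L2null).

(* The value of [F] at a point is meaningful only up to a null set. *)
Definition L2_repr (F : L2) : L2fun := repr F.
Coercion L2_repr : L2 >-> L2fun.

End SquareIntegrable.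
Arguments L2 {d T R} mu.

Section L2PreHilbert.
Context d {T : measurableType d} {R : realType}.
Variable mu : {measure set T -> \bar R}.
Local Notation L2fun := (L2fun mu).
Local Notation L2 := (L2 mu).
Implicit Types (f g h : L2fun) (F G : L2).

Definition L2class f : L2 := \pi_(L2)%qT f.

Lemma L2class_eq f g : {ae mu, forall x, f x = g x} -> L2class f = L2class g.
Proof.
move=> fg; apply/eqP; rewrite -(@Quotient.idealrBE L2fun (@L2null _ _ _ mu)).
by apply/asboolP; apply: filterS fg => x fg; rewrite -[LHS]/(f x - g x) fg subrr.
Qed.

Lemma L2class_ae f : {ae mu, forall x, L2class f x = f x}.
Proof.
have : (L2class f : L2fun) = f %[mod L2]%qT by rewrite reprK.
move/eqP; rewrite -(@Quotient.idealrBE L2fun (@L2null _ _ _ mu)) => /asboolP.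
by apply: filterS => x /eqP; rewrite -[X in X == 0]/(_ x - _ x) subr_eq0 => /eqP.
Qed.

Lemma L2reprK F : L2class F = F.
Proof. exact: reprK. Qed.

Let L2scale (a : R[i]) F : L2 := L2class (a *: (F : L2fun)).

Let L2classD f g : L2class (f + g) = L2class f + L2class g.
Proof. exact: (raddfD (\pi_(@Quotient.quot L2fun (@L2null _ _ _ mu))%qT)). Qed.

Let L2scaleE a f : L2scale a (L2class f) = L2class (a *: f).
Proof.
apply: L2class_eq; apply: filterS (L2class_ae f) => x fx.
by rewrite -[LHS]/(a * L2class f x) fx.
Qed.

Let L2scaleA a b F : L2scale a (L2scale b F) = L2scale (a * b) F.
Proof. by rewrite -[F]L2reprK !L2scaleE scalerA. Qed.
Let L2scale1 : left_id 1 L2scale.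
Proof. by move=> F; rewrite -[F]L2reprK !L2scaleE scale1r. Qed.
Let L2scaleDr : right_distributive L2scale +%R.
Proof.
move=> a F G; rewrite -[F]L2reprK -[G]L2reprK -L2classD !L2scaleE.
by rewrite -L2classD scalerDr.
Qed.
Let L2scaleDl F : {morph L2scale^~ F : a b / a + b}.
Proof. by move=> a b; rewrite -[F]L2reprK !L2scaleE -L2classD scalerDl. Qed.

HB.instance Definition _ := GRing.Zmodule_isLmodule.Build R[i] L2
  L2scaleA L2scale1 L2scaleDr L2scaleDl.

Lemma L2class_linear : linear L2class.
Proof. by move=> a f g; rewrite L2classD -L2scaleE. Qed.

Definition L2fun_inner f g : R[i] :=
  Complex (\int[mu]_x complex.Re (f x * (g x)^*))
          (\int[mu]_x complex.Im (f x * (g x)^*)).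

Let ReM (z w : R[i]) : complex.Re (z * w^*) =
  complex.Re z * complex.Re w + complex.Im z * complex.Im w.
Proof. by case: z w => [a b] [c e] /=; ring. Qed.

Let ImM (z w : R[i]) : complex.Im (z * w^*) =
  complex.Im z * complex.Re w - complex.Re z * complex.Im w.
Proof. by case: z w => [a b] [c e] /=; ring. Qed.

Let normc2E (z : R[i]) : normc z ^+ 2 = complex.Re z ^+ 2 + complex.Im z ^+ 2.
Proof. by case: z => a b /=; rewrite sqr_sqrtr ?addr_ge0 ?sqr_ge0. Qed.

Let ler_norm2 (a b c e : R) :
  `|a * c + b * e| <= a ^+ 2 + b ^+ 2 + (c ^+ 2 + e ^+ 2).
Proof.
have H (k : R) : k ^+ 2 = 1 -> k * (a * c + b * e) <= a ^+ 2 + b ^+ 2 + (c ^+ 2 + e ^+ 2).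
  move=> k1; have : 0 <= (a - k * c) ^+ 2 + (b - k * e) ^+ 2
      + (a ^+ 2 + b ^+ 2 + c ^+ 2 + e ^+ 2) by rewrite !addr_ge0// sqr_ge0.
  by rewrite !sqrrB !exprMn k1; lra.
rewrite ler_norml lerNl -mulN1r H ?sqrrN ?expr1n//=.
by have := H 1; rewrite expr1n mul1r; apply.
Qed.

Let integrable2 f : mu.-integrable setT (EFin \o (fun x => normc (f x) ^+ 2)).
Proof.
have [fr fi f2] := L2funP f; apply/integrableP; split.
  by apply/measurable_EFinP; exact: measurable_normc2.
under eq_integral do rewrite /= ger0_norm ?sqr_ge0//.
exact: f2.
Qed.

Let integrable_Re f g :
  mu.-integrable setT (EFin \o (fun x => complex.Re (f x * (g x)^*))).
Proof.
have [fr fi _] := L2funP f; have [gr gi _] := L2funP g.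
apply: (le_integrable measurableT _ _ (integrableD measurableT (integrable2 f) (integrable2 g))).
  apply/measurable_EFinP; under eq_fun do rewrite ReM.
  by apply: measurable_funD; apply: measurable_funM.
move=> x _ /=; rewrite lee_fin ReM !normc2E.
rewrite [leRHS]ger0_norm ?addr_ge0 ?sqr_ge0//.
Qed.

Let integrable_Im f g :
  mu.-integrable setT (EFin \o (fun x => complex.Im (f x * (g x)^*))).
Proof.
have [fr fi _] := L2funP f; have [gr gi _] := L2funP g.
apply: (le_integrable measurableT _ _ (integrableD measurableT (integrable2 f) (integrable2 g))).
  apply/measurable_EFinP; under eq_fun do rewrite ImM.
  by apply: measurable_funB; apply: measurable_funM.
move=> x _ /=; rewrite lee_fin ImM !normc2E.
rewrite [leRHS]ger0_norm ?addr_ge0 ?sqr_ge0//.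
have := ler_norm2 (complex.Im (f x)) (- complex.Re (f x)) (complex.Re (g x))
  (complex.Im (g x)).
by rewrite sqrrN mulNr [X in _ <= X + _]addrC.
Qed.

Let Rintegral_lin (u v w : T -> R) k l :
  mu.-integrable setT (EFin \o u) -> mu.-integrable setT (EFin \o v) ->
  mu.-integrable setT (EFin \o w) ->
  \int[mu]_x (k * u x + l * v x + w x) =
  k * (\int[mu]_x u x) + l * (\int[mu]_x v x) + \int[mu]_x w x.
Proof.
move=> ui vi wi.
have kui : mu.-integrable setT (EFin \o (fun x => k * u x)).
  exact: (integrableZl measurableT k ui).
have lvi : mu.-integrable setT (EFin \o (fun x => l * v x)).
  exact: (integrableZl measurableT l vi).
rewrite RintegralD//; last exact: (integrableD measurableT kui lvi).
by rewrite RintegralD// !RintegralZl.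
Qed.

Lemma L2fun_inner_linear a f g h :
  L2fun_inner (a *: f + g) h = a * L2fun_inner f h + L2fun_inner g h.
Proof.
have fE x : (a *: f + g) x * (h x)^* = a * (f x * (h x)^*) + g x * (h x)^*.
  by rewrite -[(a *: f + g) x]/(a * f x + g x) mulrDl mulrA.
case: a fE => a1 a2 fE.
have RE x : complex.Re ((Complex a1 a2 *: f + g) x * (h x)^*) =
    a1 * complex.Re (f x * (h x)^*) + (- a2) * complex.Im (f x * (h x)^*)
    + complex.Re (g x * (h x)^*).
  by rewrite fE; case: (f x * _) (g x * _) => [? ?] [? ?] /=; rewrite mulNr.
have IE x : complex.Im ((Complex a1 a2 *: f + g) x * (h x)^*) =
    a1 * complex.Im (f x * (h x)^*) + a2 * complex.Re (f x * (h x)^*)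
    + complex.Im (g x * (h x)^*).
  by rewrite fE; case: (f x * _) (g x * _) => [? ?] [? ?] /=.
rewrite /L2fun_inner (eq_Rintegral _ (fun x _ => RE x)).
rewrite (eq_Rintegral _ (fun x _ => IE x)) !Rintegral_lin//.
by congr Complex; rewrite mulNr// addrC.
Qed.

Lemma L2fun_innerC f g : L2fun_inner g f = (L2fun_inner f g)^*.
Proof.
rewrite /L2fun_inner; apply/eqP; rewrite eq_complex/=; apply/andP; split.
  by apply/eqP/eq_Rintegral => x _; rewrite !ReM mulrC [X in _ + X]mulrC.
rewrite -mulN1r -RintegralZl//.
by apply/eqP/eq_Rintegral => x _; rewrite !ImM; ring.
Qed.

Lemma eq_L2fun_inner f g h : {ae mu, forall x, f x = g x} ->
  L2fun_inner f h = L2fun_inner g h.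
Proof.
move=> fg; rewrite /L2fun_inner /Rintegral; congr Complex; congr fine;
  apply: ae_eq_integral => //; do ?[
    by have /integrableP[] := integrable_Re f h
   |by have /integrableP[] := integrable_Re g h
   |by have /integrableP[] := integrable_Im f h
   |by have /integrableP[] := integrable_Im g h];
  by apply: filterS fg => x -> _.
Qed.

Let L2inner F G : R[i] := L2fun_inner F G.

Lemma L2fun_inner_class f g : L2fun_inner (L2class f) (L2class g) = L2fun_inner f g.
Proof.
rewrite (eq_L2fun_inner _ (L2class_ae f)) L2fun_innerC.
by rewrite (eq_L2fun_inner _ (L2class_ae g)) -L2fun_innerC.
Qed.

Let L2inner_linear a F G F' :
  L2inner (a *: F + G) F' = a * L2inner F F' + L2inner G F'.
Proof.
rewrite -[F]L2reprK -[G]L2reprK -[F']L2reprK -L2class_linear.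
by rewrite /L2inner !L2fun_inner_class L2fun_inner_linear.
Qed.

Lemma L2class_eq0 f : L2class f = 0 -> {ae mu, forall x, f x = 0 :> R[i]}.
Proof.
move=> f0; have : L2class f == L2class 0.
  by rewrite f0; apply/eqP/(@addrI _ (L2class 0)); rewrite addr0 -L2classD addr0.
rewrite -(@Quotient.idealrBE L2fun (@L2null _ _ _ mu)) => /asboolP.
by rewrite subr0.
Qed.

Let L2innerDl F G F' : L2inner (F + G) F' = L2inner F F' + L2inner G F'.
Proof. by have := L2inner_linear 1 F G F'; rewrite scale1r mul1r. Qed.

Let L2innerZl (a : R[i]) F G : L2inner (a *: F) G = a * L2inner F G.
Proof.
have := L2inner_linear a F 0 G; rewrite addr0 => ->.
by have := L2innerDl 0 0 G; rewrite addr0 => /eqP;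
  rewrite addrC -subr_eq subrr eq_sym => /eqP ->; rewrite addr0.
Qed.

Let L2innerC F G : L2inner G F = (L2inner F G)^*.
Proof. exact: L2fun_innerC. Qed.

Let L2inner_gt0 F : F != 0 -> 0 < L2inner F F.
Proof.
move=> F0; rewrite /L2inner ltcE /=.
have RE x : complex.Re (F x * (F x)^*) = normc (F x) ^+ 2.
  by rewrite ReM normc2E !expr2.
have IE x : complex.Im (F x * (F x)^*) = 0 by rewrite ImM mulrC subrr.
under eq_Rintegral do rewrite IE.
rewrite /Rintegral integral0 eqxx/=.
under eq_integral do rewrite RE.
have /integrableP[mF] := integrable2 F.
under eq_integral do rewrite /= ger0_norm ?sqr_ge0//.
move=> F2; rewrite fine_gt0// F2 andbT lt_neqAle; apply/andP; split; last first.
  by apply: integral_ge0 => x _; rewrite lee_fin sqr_ge0.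
apply: contra F0 => /eqP/esym int0.
suff Fz : {ae mu, forall x, F x = 0 :> R[i]}.
  rewrite -[F]L2reprK (_ : 0 = L2class 0).
    by apply/eqP/L2class_eq; apply: filterS Fz => x ->.
  by apply: (@addrI _ (L2class 0)); rewrite addr0 -L2classD addr0.
have := ae_eq_integral_abs mu measurableT mF.
under eq_integral do rewrite /= ger0_norm ?sqr_ge0//.
move=> [/(_ int0) + _].
apply: filterS => x /(_ I)/= [] /eqP; rewrite sqrf_eq0 => /eqP.
exact: eq0_normc.
Qed.

HB.instance Definition _ := @Lmodule_hasInner.Build R L2 L2inner
  L2innerDl L2innerZl L2innerC L2inner_gt0.

End L2PreHilbert.

HB.instance Definition _ := isPointed.Build int 0.

HB.instance Definition _ := @isMeasurable.Build default_measure_display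
  int discrete_measurable discrete_measurable0
  discrete_measurableC discrete_measurableU.

Section Spaces.
Variable R : realType.

(* Lebesgue measure on [0, 1], seen as a measure on the line carried by [0, 1]. *)
Definition lebesgue01 : {measure set (measurableTypeR R) -> \bar R} :=
  mrestr (@lebesgue_measure R) (measurable_itv `[0%R, 1%R]).

Definition L2_01 : Type := L2 lebesgue01.
HB.instance Definition _ := PreHilbert.on L2_01.

(* l^2(Z), as the L^2 space of the counting measure. *)
Definition ell2_int : Type := L2 (@counting int R).
HB.instance Definition _ := PreHilbert.on ell2_int.

Let measurable_int d' (T' : measurableType d') (f : int -> T') :
  measurable_fun setT f.
Proof. by []. Qed.

Let counting1 (m : int) : @counting int R [set m] = 1%:E.
Proof. by rewrite /counting (asboolT (finite_set1 m)) fset_set1 finmap.cardfs1. Qed.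

Fact ell2_delta_subproof (m : int) :
  ((fun k : int => (k == m)%:R) : int -> R[i]^o)
    \in square_integrable_pred (@counting int R).
Proof.
apply/asboolP; split; [exact: measurable_int|exact: measurable_int|].
have E (k : int) : normc ((k == m)%:R : R[i]) ^+ 2 = \1_[set m] k.
  rewrite indicE; have [->|km] := eqVneq k m.
    by rewrite normc1 expr1n mem_set.
  by rewrite normc0 expr0n/= memNset//= => /eqP; rewrite (negPf km).
under eq_integral do rewrite E.
by rewrite integral_indic// setIT [X in (X < _)%E]counting1 ltry.
Qed.

(* The basis vector xi_m. *)
Definition ell2_delta (m : int) : ell2_int :=
  L2class (L2Fun (ell2_delta_subproof m)).

Fact ell2_nontrivial : exists x : ell2_int, x != 0.
Proof.
exists (ell2_delta 0); apply/eqP => /L2class_eq0 [N [_ N0 subN]].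
have [N00|] := pselect (N 0); last first.
  by apply; apply: subN => /= /eqP; rewrite oner_eq0.
have : (@counting int R [set 0%R] <= @counting int R N)%E.
  by rewrite le_measure ?inE// => _ ->.
by rewrite [X in (_ <= X)%E]N0 [X in (X <= _)%E]counting1 lee_fin ler10.
Qed.

Fact L2_01_nontrivial : exists x : L2_01, x != 0.
Proof.
have one2 : ((fun=> 1) : R -> R[i]^o) \in square_integrable_pred lebesgue01.
  apply/asboolP; split; [exact: measurable_cst|exact: measurable_cst|].
  rewrite (@integral_cst _ _ _ lebesgue01 _ measurableT).
  rewrite normc1 expr1n mul1e /lebesgue01/= /mrestr setTI.
  by rewrite lebesgue_measure_itv/= lte01 ltry.
exists (L2class (L2Fun one2)); apply/eqP => /L2class_eq0 [N [_ N0 subN]].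
have NT : N = setT.
  by apply/seteqP; split => // x _; apply: subN => /= /eqP; rewrite oner_eq0.
move: N0; rewrite NT /lebesgue01/= /mrestr setTI lebesgue_measure_itv/= lte01.
by rewrite oppr0 addr0 => /eqP; rewrite eqe oner_eq0.
Qed.

HB.instance Definition _ := PreHilbert_isNontrivial.Build R ell2_int ell2_nontrivial.
HB.instance Definition _ := PreHilbert_isNontrivial.Build R L2_01 L2_01_nontrivial.

End Spaces.

Section CStarTheory.
Context {R : realType}.

(* The domain [D] is a unital *-subalgebra of [A]; the values of [f] outside
   [D] play no role. *)
Definition star_hom_on {A B : starAlgType R} (D : set A) (f : A -> B) : Prop :=
  [/\ f 1 = 1,
      forall a b, D a -> D b -> f (a + b) = f a + f b,
      forall (c : R[i]) a, D a -> f (c *: a) = c *: f a,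
      forall a b, D a -> D b -> f (a * b) = f a * f b &
      forall a, D a -> f (star a) = star (f a)].

Definition representation_on {A : starAlgType R} {H : nzPreHilbertType R}
    (D : set A) (f : A -> bounded_operator H) : Prop := star_hom_on D f.

Definition cstar_subalgebra {A : cstarAlgType R} (D : set A) : Prop :=
  [/\ forall a b, D a -> D b -> D (a + b),
      forall (c : R[i]) a, D a -> D (c *: a),
      forall a b, D a -> D b -> D (a * b),
      forall a, D a -> D (star a) &
      forall (x : nat -> A) a, (forall n, D (x n)) ->
        cnorm (x n - a) @[n --> \oo] --> (0 : R) -> D a].

Definition padic_relations {A : starAlgType R} (p : nat) (u s : A) : Prop :=
  [/\ star u * u = 1, u * star u = 1, star s * s = 1, s * u = u ^+ p * s &
      \sum_(i < p) u ^+ i * s * star s * star u ^+ i = 1].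

(* [A], [u], [s] is a model of the p-adic ring C*-algebra. As usual for a
   C*-algebra given by generators and relations, universality is tested against
   operators on Hilbert spaces (the zero space, where it is void, excepted);
   the morphism [f] is unique since [u] and [s] generate [A]. *)
Definition padic_ring_algebra (p : nat) (A : cstarAlgType R) (u s : A) : Prop :=
  [/\ padic_relations p u s,
      smallest cstar_subalgebra [set u; s] = setT &
      forall (H : hilbertType R) (U S : bounded_operator H),
        padic_relations p U S ->
        exists f : A -> bounded_operator H,
          [/\ representation_on setT f, f u = U & f s = S]].

Definition cuntz_isometry {A : starAlgType R} (u s : A) (i : nat) : A :=
  u ^+ i * s.

(* The copy of the Cuntz algebra O_p inside [A]. *)
Definition cuntz_subalgebra (p : nat) {A : cstarAlgType R} (u s : A) : set A :=
  smallest cstar_subalgebra [set cuntz_isometry u s i | i in `I_p].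

(* The range projection of an isometry [w] is [w * star w]. *)
Definition pure_isometry {H : nzPreHilbertType R} (v : bounded_operator H) :
    Prop :=
  star v * v = 1 /\
  forall x : H, (v ^+ n * star (v ^+ n)) x @[n --> \oo] --> (0 : H).

Definition unitarily_equivalent {A : starAlgType R} {H K : nzPreHilbertType R}
    (f : A -> bounded_operator H) (g : A -> bounded_operator K) : Prop :=
  exists W : H -> K,
    [/\ linear W, forall y, exists x, W x = y,
        forall x y, inner (W x) (W y) = inner x y &
        forall a x, W (f a x) = g a (W x)].

(* [v] acts by f |-> sqrt p * (f o h_i^-1) on [i/p, (i+1)/p] and by 0 elsewhere,
   where h_i t = (i + t) / p, so that h_i^-1 t = p * t - i. *)
Definition interval_picture_op (p i : nat) (v : bounded_operator (L2_01 R)) :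
    Prop :=
  forall f : L2_01 R, {ae lebesgue01 R, forall t : R,
    L2_repr (v f) t =
      if t \in `[i%:R / p%:R, i.+1%:R / p%:R]
      then ((Num.sqrt p%:R)%:C)%C * L2_repr f (p%:R * t - i%:R) else 0}.

Definition interval_picture (p : nat) {A : cstarAlgType R} (u s : A)
    (sigma : A -> bounded_operator (L2_01 R)) : Prop :=
  representation_on (cuntz_subalgebra p u s) sigma /\
  forall i, (i < p)%N -> interval_picture_op p i (sigma (cuntz_isometry u s i)).

Definition canonical_representation (p : nat) {A : cstarAlgType R} (u s : A)
    (pi : A -> bounded_operator (ell2_int R)) : Prop :=
  [/\ representation_on setT pi,
      forall m : int, pi u (ell2_delta R m) = ell2_delta R (m + 1) &
      forall m : int, pi s (ell2_delta R m) = ell2_delta R (p%:Z * m)].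

End CStarTheory.

(* Main.v *)
Require Import Defs.
From HB Require Import structures.
From mathcomp Require Import all_boot all_order all_algebra.
From mathcomp Require Import complex.
From mathcomp Require Import all_classical all_reals all_analysis.
From mathcomp Require Import measurable_realfun ring lra.

Set Implicit Arguments.
Unset Strict Implicit.
Unset Printing Implicit Defensive.

Import Order.TTheory GRing.Theory Num.Theory.
Import numFieldNormedType.Exports.

Local Open Scope classical_set_scope.
Local Open Scope ring_scope.

(** Write [T i = u^i s] and [S i = sigma (T i)].

    Purity. The operator [(S i)^n] only produces functions carried by the
    interval of radius [p^-n] around the fixed point [i / (p - 1)] of
    [t |-> (i + t) / p]. The projection of [x] on its range is therefore bounded
    by the norm of the restriction of [x] to this interval, which tends to 0 by
    dominated convergence ([interval_picture_pure]).

    Extension. Since the range projections of the [T i] sum to 1, and since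
    [s u = u^p s], the unitary [u] satisfies in [Qp] the odometer equation
    [u = B + T 0 * u * star (T (p - 1))], where [B] is the sum over [i < p - 1]
    of [T i.+1 * star (T i)] ([padic_odometer]): addition of one to a p-adic
    integer changes the first digit only, or carries. In the operators on a
    Hilbert space, iterating this equation gives partial sums that converge
    strongly, because [S 0] and [S (p - 1)] are pure, and whose limit is a
    unitary solution ([odometer_equation]); the solution is unique
    ([odometer_equation_unique]). The solution [U] and [S 0] satisfy the
    relations of [Qp] ([cuntz_extension]), so the universal property provides
    [sigma']. It is tested on Hilbert spaces, whence the completeness of L^2,
    the Riesz-Fischer theorem ([L2_complete]). Conversely every extension of
    [sigma] maps [u] to a solution, that is to [U].

    Two *-homomorphisms that agree on generators agree on the C*-algebra that
    these generate ([star_hom_on_unique]); this is applied to the [T i] for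
    [sigma'] and [sigma], and to [u] and [s] for two extensions. It depends on
    the continuity of *-homomorphisms, obtained from a square root of
    [1 - star a * a] for [a] small ([sqrt_one_sub], [star_hom_on_bounded]).

    Inequivalence. In the canonical representation [s] fixes the basis vector
    of index 0, whereas the pure isometry [sigma' s = S 0] has no nonzero fixed
    vector ([pure_isometry_fixed0]). *)

(** * *-algebras *)

Section StarAlgebraTheory.
Context {R : realType} {A : starAlgType R}.
Implicit Types a : A.

Lemma star0 : star (0 : A) = 0.
Proof. by rewrite -(scale0r (0 : A)) starZ rmorph0 !scale0r. Qed.

Lemma starN a : star (- a) = - star a.
Proof. by rewrite -scaleN1r starZ rmorphN rmorph1 scaleN1r. Qed.

Lemma star1 : star (1 : A) = 1.
Proof. by rewrite -[LHS]mulr1 -{2}[1]starK -starM mulr1 starK. Qed.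

Lemma starX a n : star (a ^+ n) = star a ^+ n.
Proof.
elim: n => [|n IHn]; first by rewrite !expr0 star1.
by rewrite exprS starM IHn -exprSr.
Qed.

Lemma star_sum n (a : 'I_n -> A) :
  star (\sum_(i < n) a i) = \sum_(i < n) star (a i).
Proof. exact: (big_morph _ starD star0). Qed.

Lemma isometryX a n : star a * a = 1 -> star a ^+ n * a ^+ n = 1.
Proof.
move=> a1; elim: n => [|n IHn]; first by rewrite !expr0 mulr1.
by rewrite exprSr exprS mulrA -(mulrA (star a ^+ n)) a1 mulr1.
Qed.

End StarAlgebraTheory.

(** * Continuity of *-homomorphisms *)

Lemma normc_realE (R : realType) (x : R) : Normc.normc x%:C%C = `|x|.
Proof. by rewrite /= expr0n addr0 sqrtr_sqr. Qed.

Section CStarNorm.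
Context {R : realType} {A : cstarAlgType R}.
Implicit Types (a b : A) (D : set A).

Lemma cnorm0 : cnorm (0 : A) = 0.
Proof. by rewrite -(scale0r (0 : A)) cnormZ Normc.normc0 mul0r. Qed.

Lemma cnormN a : cnorm (- a) = cnorm a.
Proof. by rewrite -scaleN1r cnormZ normcN Normc.normc1 mul1r. Qed.

Lemma cnorm_ge0 a : 0 <= cnorm a.
Proof.
have := ler_cnormD a (- a); rewrite subrr cnorm0 cnormN.
by rewrite -mulr2n pmulrn_lge0.
Qed.

Lemma cnorm_star a : cnorm (star a) = cnorm a.
Proof.
have le_star b : cnorm b <= cnorm (star b).
  have [->|b0] := eqVneq b 0; first by rewrite star0.
  have := ler_cnormM (star b) b; rewrite cnorm_starM expr2 ler_pM2r//.
  rewrite lt_neqAle cnorm_ge0 andbT eq_sym.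
  by apply: contra b0 => /eqP/cnorm0_eq0 ->.
by apply/eqP; rewrite eq_le le_star andbT -{2}[a]starK le_star.
Qed.

Lemma smallest_cstar_subalgebra (G : set A) :
  cstar_subalgebra (smallest cstar_subalgebra G).
Proof.
split.
- by move=> a b Da Db D DG; have [[DD _ _ _ _] _] := DG; apply: DD; [exact: Da|exact: Db].
- by move=> c a Da D DG; have [[_ DZ _ _ _] _] := DG; apply: DZ; exact: Da.
- by move=> a b Da Db D DG; have [[_ _ DM _ _] _] := DG; apply: DM; [exact: Da|exact: Db].
- by move=> a Da D DG; have [[_ _ _ DS _] _] := DG; apply: DS; exact: Da.
- move=> x a Dx xa D DG; have [[_ _ _ _ DL] _] := DG; apply: DL xa => n.
  exact: Dx DG.
Qed.

(** The map [b |-> (h + b^2) / 2] contracts the ball of radius 1/2 with ratio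
    1/2, so that iterating it from 0 converges inside [D], and its fixed points
    are the [b] such that [1 - h = (1 - b)^2]. This replaces the square root
    that the functional calculus would give. *)
Lemma sqrt_one_sub D h : cstar_subalgebra D -> D 1 -> D h -> star h = h ->
  cnorm h <= 2^-1 ->
  exists b, [/\ D b, star b = b & 1 - h = (1 - b) * (1 - b)].
Proof.
move=> [DD DZ DM DS DL] D1 Dh hs h_le.
pose F b := 2^-1 *: (h + b * b).
have half : Normc.normc (2^-1 : R[i]) = 2^-1.
  by rewrite Normc.normcV -(rmorph_nat (real_complex R)) normc_realE ger0_norm.
have FB b c : cnorm (F b - F c) <= 2^-1 * ((cnorm b + cnorm c) * cnorm (b - c)).
  rewrite /F -scalerBr cnormZ.
  rewrite half ler_pM2l ?invr_gt0//.
  have -> : h + b * b - (h + c * c) = b * (b - c) + (b - c) * c.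
    by rewrite opprD addrACA subrr add0r mulrBr mulrBl addrA subrK.
  rewrite [leRHS]mulrDl (le_trans (ler_cnormD _ _))//.
  by rewrite lerD ?ler_cnormM// [leRHS]mulrC ler_cnormM.
have [b [b00 bS]] : exists b : nat -> A, b 0%N = 0 /\ forall n, b n.+1 = F (b n).
  by exists (fun n => iter n F 0).
have b_le n : cnorm (b n) <= 2^-1.
  elim: n => [|n IHn]; first by rewrite b00 cnorm0 invr_ge0.
  have := ler_cnormD (F (b n) - F 0) (F 0); rewrite subrK bS.
  have -> : F 0 = 2^-1 *: h by rewrite /F mulr0 addr0.
  have := FB (b n) 0; rewrite subr0 cnorm0.
  have -> : F 0 = 2^-1 *: h by rewrite /F mulr0 addr0.
  rewrite (cnormZ _ h) half.
  have := cnorm_ge0 (b n); nra.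
have b_cauchy n k : cnorm (b (n + k)%N - b n) <= 2^-1 ^+ n.
  elim: n => [|n IHn].
    by rewrite b00 subr0 expr0 (le_trans (b_le _))// invf_le1 ?ler1n.
  rewrite addSn !bS (le_trans (FB _ _))// exprS ler_pM2l ?invr_gt0//.
  rewrite (le_trans _ IHn)// ler_piMl ?cnorm_ge0//.
  by have := b_le (n + k)%N; have := b_le n; lra.
have [b0 b0P] : exists b0, cnorm (b n - b0) @[n --> \oo] --> (0 : R).
  apply: cnorm_complete => e e0.
  have /cvgrPdist_lt/(_ _ e0)[N _ NP] : (2^-1 : R) ^+ n @[n --> \oo] --> 0.
    by apply: cvg_expr; rewrite ger0_norm ?invr_ge0// invf_lt1 ?ltr1n.
  exists N.
  suff H m n : (N <= m)%N -> (m <= n)%N -> cnorm (b n - b m) < e.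
    move=> m n Nm Nn; have [mn|/ltnW nm] := leqP m n; last exact: H.
    by rewrite -cnormN opprB H.
  move=> Nm mn; rewrite -(subnKC mn) (le_lt_trans (b_cauchy _ _))//.
  by have := NP m Nm; rewrite /= sub0r normrN ger0_norm ?exprn_ge0// invr_ge0.
have Db n : D (b n).
  elim: n => [|n IHn]; last by rewrite bS; apply/DZ/DD => //; exact: DM.
  by rewrite b00 -(scale0r 1); exact: DZ.
have bs n : star (b n) = b n.
  elim: n => [|n IHn]; first by rewrite b00 star0.
  rewrite bS /F starZ starD hs starM IHn.
  by rewrite (_ : (_^* )%R = 2^-1)// fmorphV rmorph_nat.
(* An equality holds as soon as its defect is controlled by the distances of
   the iterates to [b0], which tend to 0. *)
have eq_lim (x y : A) (C : R) :
    (forall n, cnorm (x - y) <= C * (cnorm (b n - b0) + cnorm (b n.+1 - b0))) ->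
    x = y.
  move=> xy; apply/eqP; rewrite -subr_eq0; apply/eqP/cnorm0_eq0/le_anti/andP.
  split; last exact: cnorm_ge0.
  have lim0 : C * (cnorm (b n - b0) + cnorm (b n.+1 - b0)) @[n --> \oo] --> (0 : R).
    rewrite -(mulr0 C); apply: cvgM; first exact: cvg_cst.
    rewrite -(addr0 0); apply: cvgD => //.
    by rewrite (cvg_shiftS (fun n => cnorm (b n - b0))).
  rewrite -(cvg_lim _ lim0)//; apply: limr_ge; first exact: cvgP lim0.
  by apply: nearW.
exists b0; split.
- exact: DL b0P.
- apply: (eq_lim _ _ 2) => n.
  rewrite (_ : star b0 - b0 = star (b0 - b n) + (b n - b0)); last first.
    by rewrite starD starN bs addrA subrK.
  rewrite (le_trans (ler_cnormD _ _))// cnorm_star -cnormN opprB.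
  by have := cnorm_ge0 (b n.+1 - b0); lra.
- have FE : b0 = F b0.
    apply: (eq_lim _ _ (1 + cnorm b0)) => n.
    rewrite (_ : b0 - F b0 = (b0 - b n.+1) + (F (b n) - F b0)); last first.
      by rewrite -bS addrA subrK.
    rewrite (le_trans (ler_cnormD _ _))// -cnormN opprB.
    have := FB (b n) b0; have := b_le n; have := cnorm_ge0 b0.
    have := cnorm_ge0 (b n - b0); have := cnorm_ge0 (b n.+1 - b0); nra.
  have -> : h = 2%:R *: b0 - b0 * b0.
    by rewrite {1}FE scalerA divff ?pnatr_eq0// scale1r addrK.
  by rewrite mulrBl mul1r mulrBr mulr1 scaler_nat mulr2n -(addrA b0) opprD addrA.
Qed.

End CStarNorm.

Section AutomaticContinuity.
Context {R : realType} {A : cstarAlgType R} {H : nzPreHilbertType R}.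
Implicit Types (D : set A) (f g : A -> bounded_operator H).

Lemma star_hom_onN D f a : star_hom_on D f -> D a -> f (- a) = - f a.
Proof. by move=> [_ _ fZ _ _] Da; rewrite -scaleN1r fZ// scaleN1r. Qed.

(** If [1 - star a * a = (1 - b)^2] with [b] self-adjoint, then
    [|x|^2 - |f a x|^2 = |f (1 - b) x|^2] is nonnegative. *)
Lemma star_hom_on_contract D f a x : cstar_subalgebra D -> D 1 ->
  star_hom_on D f -> D a -> cnorm a ^+ 2 <= 2^-1 -> `|f a x| <= `|x|.
Proof.
move=> Dsub D1 fhom Da a_le; have [DD DZ DM DS DL] := Dsub.
have [f1 fD fZ fM fS] := fhom.
have Dh : D (star a * a) by apply: DM => //; exact: DS.
have [||b [Db bs E]] := @sqrt_one_sub _ _ D (star a * a) Dsub D1 Dh.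
  by rewrite starM starK.
  by rewrite cnorm_starM.
have DN c : D c -> D (- c) by move=> Dc; rewrite -scaleN1r; exact: DZ.
have D1b : D (1 - b) by apply: DD => //; exact: DN.
rewrite -(ler_pXn2r (n := 2))// ?nnegrE// -!inner_normE -subr_ge0.
have -> : inner x x - inner (f a x) (f a x) = inner (f (1 - b) x) (f (1 - b) x).
  rewrite !bounded_operator_starP -!fS//.
  rewrite (_ : star (1 - b) = 1 - b); last by rewrite starD starN star1 bs.
  rewrite -[f _ (f a x)]/((f (star a) * f a) x) -fM//; last exact: DS.
  rewrite -[f _ (f (1 - b) x)]/((f (1 - b) * f (1 - b)) x) -fM// -E fD//; last exact: DN.
  rewrite f1 (star_hom_onN fhom)// bounded_operator_addE innerDr; congr (_ + _).
  by rewrite -(scaleN1r (f _)) bounded_operator_scaleE innerZr rmorphN rmorph1 mulN1r.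
by rewrite inner_normE exprn_ge0.
Qed.

(** Rescaling [a] to norm 1/2 reduces to the previous lemma. The constant 2 is
    not sharp, but only the continuity of [f] matters. *)
Lemma star_hom_on_bounded D f a x : cstar_subalgebra D -> D 1 ->
  star_hom_on D f -> D a -> `|f a x| <= (2 * cnorm a)%:C%C * `|x|.
Proof.
move=> Dsub D1 fhom Da; have [DD DZ DM DS DL] := Dsub.
have [f1 fD fZ fM fS] := fhom.
have [->|a0] := eqVneq a 0.
  have -> : f 0 = 0 by rewrite -(scale0r 1) fZ// scale0r.
  by rewrite [(0 : bounded_operator H) x]/(0 : H) normr0 mulr_ge0// ler0c mulr_ge0// cnorm_ge0.
have na : 0 < cnorm a.
  by rewrite lt_neqAle cnorm_ge0 andbT eq_sym; apply: contra a0 => /eqP/cnorm0_eq0 ->.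
pose c := 2 * cnorm a; have c0 : 0 < c by rewrite mulr_gt0.
rewrite -/c -ler_pdivrMl ?ltcR//.
have small : cnorm ((c%:C)^-1%C *: a) ^+ 2 <= 2^-1.
  rewrite cnormZ Normc.normcV normc_realE (ger0_norm (ltW c0)).
  rewrite /c invfM -mulrA mulVf ?gt_eqF// mulr1.
  by rewrite expr2 ger_pMl ?invr_gt0// invf_le1// ler1n.
have := star_hom_on_contract x Dsub D1 fhom (DZ _ _ Da) small.
rewrite fZ// bounded_operator_scaleE normrZ normfV.
by rewrite [`|c%:C%C|]ger0_norm// ler0c (ltW c0).
Qed.

(** Two *-homomorphisms that agree on generators agree on the C*-algebra they
    generate: by automatic continuity the agreement set is closed. *)
Lemma star_hom_on_unique (G : set A) f g :
  let D := smallest cstar_subalgebra G in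
  D 1 -> star_hom_on D f -> star_hom_on D g ->
  (forall a, G a -> f a = g a) -> forall a, D a -> f a = g a.
Proof.
move=> D D1 fhom ghom fg a Da.
have Dsub : cstar_subalgebra D := smallest_cstar_subalgebra G.
have [DD DZ DM DS DL] := Dsub.
have [f1 fD fZ fM fS] := fhom; have [g1 gD gZ gM gS] := ghom.
suff Esub : cstar_subalgebra [set a | D a /\ f a = g a].
  have [] // := Da [set a | D a /\ f a = g a].
  by split=> // b Gb; split; [move=> E [_]; apply|exact: fg].
split.
- by move=> b c [Db fgb] [Dc fgc]; split; [exact: DD|rewrite fD// gD// fgb fgc].
- by move=> k b [Db fgb]; split; [exact: DZ|rewrite fZ// gZ// fgb].
- by move=> b c [Db fgb] [Dc fgc]; split; [exact: DM|rewrite fM// gM// fgb fgc].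
- by move=> b [Db fgb]; split; [exact: DS|rewrite fS// gS// fgb].
move=> y b Dy yb.
have Db : D b by apply: DL yb => n; have [] := Dy n.
split=> //; apply: bounded_operatorP => x.
apply/eqP; rewrite -subr_eq0 -normr_eq0 -[`|_|]RRe_real ?ger0_real//.
set e := complex.Re `|_|.
suff : e <= 0.
  by rewrite le_eqVlt => /predU1P[->//|]; rewrite ltNge -lecR RRe_real ?ger0_real// normr_ge0.
pose M := 4 * complex.Re `|x|.
have lim0 : M * cnorm (y n - b) @[n --> \oo] --> (0 : R).
  by rewrite -(mulr0 M); apply: cvgM => //; exact: cvg_cst.
rewrite -(cvg_lim _ lim0)//; apply: limr_ge; first exact: cvgP lim0.
apply: nearW => n; have [Dyn fgn] := Dy n.
rewrite -lecR rmorphM /M rmorphM /= !RRe_real ?ger0_real//.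
have DNb : D (- b) by rewrite -scaleN1r; exact: DZ.
have bound (h : A -> bounded_operator H) : star_hom_on D h ->
    `|h (y n) x - h b x| <= (2 * cnorm (y n - b))%:C%C * `|x|.
  move=> hhom; have := @star_hom_on_bounded D h (y n - b) x Dsub D1 hhom (DD _ _ Dyn DNb).
  by have [_ -> // _ _ _] := hhom; rewrite (star_hom_onN hhom).
rewrite -(subrKA (g (y n) x)) -{1}fgn (le_trans (ler_normD _ _))//.
have := lerD (bound f fhom) (bound g ghom).
rewrite -[X in X + _]normrN opprB => /le_trans; apply.
by rewrite -mulrDl -rmorphD -mulrDl -natrD mulrAC -rmorphM.
Qed.

End AutomaticContinuity.

(** * Completeness of L^2 *)

Lemma cauchy_tail_cvg (K : numFieldType) (V : completeNormedModType K)
    (W : normedModType K) (u : nat -> V) (z : nat -> W) :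
  (forall n k, `|u (n + k)%N - u n| <= `|z n|) ->
  z n @[n --> \oo] --> (0 : W) -> cvg (u n @[n --> \oo]).
Proof.
move=> uz /cvgr0Pnorm_lt z0; apply/cauchy_cvgP/cauchy_exP => e e0.
have [N _ NP] := z0 _ e0; exists (u N); exists N => // n /= Nn.
rewrite -ball_normE /= distrC -(subnKC Nn).
by rewrite (le_lt_trans (uz _ _))//; apply: NP => /=.
Qed.


Lemma cvg_half (R : realType) (C : R) : C * 2^-1 ^+ n @[n --> \oo] --> (0 : R).
Proof.
rewrite -(mulr0 C); apply: cvgM; first exact: cvg_cst.
by apply: cvg_expr; rewrite ger0_norm ?invr_ge0// invf_lt1 ?ltr1n.
Qed.

Lemma geometric_cauchy (R : realType) (u : nat -> R) (C : R) :
  (forall k j, `|u (k + j)%N - u k| <= C * 2^-1 ^+ k) ->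
  cvg (u n @[n --> \oo]) /\
  forall k, `|limn u - u k| <= C * 2^-1 ^+ k.
Proof.
move=> uC; have C0 : 0 <= C.
  by have := uC 0%N 0%N; rewrite expr0 mulr1; apply: le_trans.
have ucvg : cvg (u n @[n --> \oo]).
  apply: (@cauchy_tail_cvg _ R R u (fun n => C * 2^-1 ^+ n)); last exact: cvg_half.
  by move=> n k; rewrite [leRHS]ger0_norm ?mulr_ge0// exprn_ge0 ?invr_ge0.
split=> // k.
have dcvg : `|u n - u k| @[n --> \oo] --> `|limn u - u k|.
  by apply: cvg_norm; apply: cvgB => //; exact: cvg_cst.
rewrite -(cvg_lim _ dcvg)//; apply: limr_le; first exact: cvgP dcvg.
by exists k => // n /= kn; rewrite -(subnKC kn).
Qed.

Section RieszFischer.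
Context d {T : measurableType d} {R : realType}.
Variable mu : {measure set T -> \bar R}.
Local Notation normc := Normc.normc.

Lemma normc_sqrE (z : R[i]) : normc z ^+ 2 = complex.Re z ^+ 2 + complex.Im z ^+ 2.
Proof. by case: z => a b /=; rewrite sqr_sqrtr ?addr_ge0 ?sqr_ge0. Qed.

Lemma normc_ge0 (z : R[i]) : 0 <= normc z.
Proof. by case: z => a b; rewrite sqrtr_ge0. Qed.

Lemma norm_Re_le (z : R[i]) : `|complex.Re z| <= normc z.
Proof.
rewrite -(ler_pXn2r (n := 2))// ?nnegrE ?normc_ge0// normc_sqrE real_normK ?num_real//.
by rewrite lerDl sqr_ge0.
Qed.

Lemma norm_Im_le (z : R[i]) : `|complex.Im z| <= normc z.
Proof.
rewrite -(ler_pXn2r (n := 2))// ?nnegrE ?normc_ge0// normc_sqrE real_normK ?num_real//.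
by rewrite lerDr sqr_ge0.
Qed.

Lemma L2_norm_sqrE (f : L2fun mu) :
  `|L2class f| ^+ 2 = (\int[mu]_x (normc (f x) ^+ 2))%:C%C.
Proof.
rewrite -inner_normE [LHS]L2fun_inner_class /L2fun_inner.
congr Complex.
  by apply: eq_Rintegral => x _; rewrite normc_sqrE; case: (f x) => a b /=; ring.
rewrite (_ : (fun x => _) = cst 0); last first.
  by apply/funext => x; case: (f x) => a b /=; ring.
by rewrite /Rintegral integral0.
Qed.

Lemma L2_measurable_normc2 (f : L2fun mu) :
  measurable_fun setT (fun x => (normc (f x) ^+ 2)%:E).
Proof.
by have [fr fi _] := L2funP f; apply/measurable_EFinP; exact: measurable_normc2.
Qed.

Lemma L2_norm_sqr_le (f : L2fun mu) (C : R) : 0 <= C ->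
  (`|L2class f| ^+ 2 <= C%:C%C) = (\int[mu]_x (normc (f x) ^+ 2)%:E <= C%:E)%E.
Proof.
move=> C0; have [_ _ fi] := L2funP f.
rewrite L2_norm_sqrE lecR -lee_fin fineK// ge0_fin_numE//.
by apply: integral_ge0 => x _; rewrite lee_fin sqr_ge0.
Qed.

(** The step of rank [k] has modulus at most [sqrt C * 2^-k], and a geometric
    tail of ratio 1/2 sums to twice its first term. *)
Lemma weighted_steps_cauchy (z : nat -> R[i]) (C : R) :
  (forall k, 4 ^+ k * normc (z k.+1 - z k) ^+ 2 <= C) ->
  forall k j, normc (z (k + j)%N - z k) <= 2 * Num.sqrt C * 2^-1 ^+ k.
Proof.
move=> zC; have C0 : 0 <= C.
  by rewrite (le_trans _ (zC 0%N))// mulr_ge0 ?sqr_ge0// exprn_ge0.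
have step k : normc (z k.+1 - z k) <= Num.sqrt C * 2^-1 ^+ k.
  rewrite -(ler_pXn2r (n := 2))// ?nnegrE ?normc_ge0//.
  rewrite exprMn sqr_sqrtr// -exprM mulnC exprM -ler_pdivrMr; last first.
    by rewrite exprn_gt0// exprn_gt0// invr_gt0.
  rewrite mulrC !exprVn invrK.
  by rewrite (_ : 2 ^+ 2 = 4) ?zC// -natrX.
move=> k j; elim: j k => [|j IHj] k.
  by rewrite addn0 subrr Normc.normc0 mulr_ge0 ?mulr_ge0 ?sqrtr_ge0 ?exprn_ge0 ?invr_ge0.
rewrite addnS -addSn -(subrKA (z k.+1)) (le_trans (le_normcD _ _))//.
rewrite (le_trans (lerD (IHj _) (step _)))// exprS.
by rewrite le_eqVlt; apply/orP; left; apply/eqP; field.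
Qed.

(** Weighting the squared increments by [4^k] keeps their total integral finite,
    and at every point where the weighted sum [S] is finite the sequence is
    geometrically Cauchy, with an error controlled by [S] itself. *)
Lemma L2_fast_cauchy_cvg (f : nat -> L2fun mu) :
  (forall k, `|L2class (f k.+1 - f k)| ^+ 2 <= (8 ^- k / 2)%:C%C) ->
  exists g : L2fun mu, forall k,
    `|L2class (g - f k)| ^+ 2 <= (8 * 4 ^- k)%:C%C.
Proof.
move=> f_fast.
pose w k x := (4 ^+ k * normc (f k.+1 x - f k x) ^+ 2)%:E : \bar R.
have w0 k x : (0 <= w k x)%E by rewrite lee_fin mulr_ge0 ?sqr_ge0// exprn_ge0.
have mw k : measurable_fun setT (w k).
  rewrite /w; under eq_fun do rewrite EFinM.
  by apply: measurable_funeM; exact: (L2_measurable_normc2 (f k.+1 - f k)).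
pose S x := (\sum_(0 <= k <oo) w k x)%E.
have S0 x : (0 <= S x)%E by apply: nneseries_ge0.
have mS : measurable_fun setT S.
  by apply: ge0_emeasurable_sum => // k x _ _.
have intS : (\int[mu]_x S x <= 1%:E)%E.
  rewrite /S integral_nneseries//.
  apply: le_trans (@epsilon_trick0 R 1 xpredT ler01).
  apply: lee_nneseries => [k _ _|k _]; first exact: integral_ge0.
  have := f_fast k; rewrite L2_norm_sqr_le; last first.
    by rewrite divr_ge0// invr_ge0 exprn_ge0.
  rewrite /w; under [in X in _ -> X]eq_integral do rewrite EFinM.
  rewrite ge0_integralZl_EFin//; last 2 first.
  - by move=> x _; rewrite lee_fin sqr_ge0.
  - exact: (L2_measurable_normc2 (f k.+1 - f k)).
  move=> fk; apply: le_trans (lee_wpmul2l _ fk) _.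
    by rewrite lee_fin exprn_ge0.
  rewrite -EFinM lee_fin.
  have -> : (8 : R) ^- k = 4 ^- k * 2 ^- k.
    by rewrite -invfM -exprMn -natrM.
  rewrite !mulrA divff ?mul1r ?expf_neq0//.
  by rewrite natrX exprSr invfM.
pose E x := (S x < +oo)%E.
have mE : measurable_fun setT E.
  by apply: measurable_fun_lte; [exact: mS|exact: measurable_cst].
have aeE : {ae mu, forall x, E x}.
  have : mu.-integrable setT S.
    apply/integrableP; split=> //.
    under eq_integral do rewrite gee0_abs//.
    exact: le_lt_trans intS (ltry _).
  move/(integrable_ae measurableT); apply: filterS => x /(_ I).
  by rewrite ge0_fin_numE.
(* [h k] is [f k] almost everywhere, and converges at every point. *)
pose h k x : R[i] := if E x then f k x else 0.
have h_cauchy x k j : normc (h (k + j)%N x - h k x) <= 2 * Num.sqrt (fine (S x)) * 2^-1 ^+ k.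
  rewrite /h; have [Ex|_] := boolP (E x); last first.
    by rewrite subrr Normc.normc0 mulr_ge0 ?mulr_ge0 ?sqrtr_ge0 ?exprn_ge0 ?invr_ge0.
  apply: (@weighted_steps_cauchy (fun k => f k x)) => {}k.
  rewrite -lee_fin fineK; last by rewrite ge0_fin_numE.
  rewrite /S (@nneseriesD1 _ _ k)//.
  by rewrite leeDl// nneseries_ge0.
have ReB (a b : R[i]) : complex.Re a - complex.Re b = complex.Re (a - b).
  by case: a b => [? ?] [? ?].
have ImB (a b : R[i]) : complex.Im a - complex.Im b = complex.Im (a - b).
  by case: a b => [? ?] [? ?].
have hRe x : cvgn (fun k => complex.Re (h k x)) /\
    forall k, `|limn (fun k => complex.Re (h k x)) - complex.Re (h k x)| <=
      2 * Num.sqrt (fine (S x)) * 2^-1 ^+ k.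
  apply: (@geometric_cauchy R (fun k => complex.Re (h k x))) => k j.
  by rewrite ReB (le_trans (norm_Re_le _)).
have hIm x : cvgn (fun k => complex.Im (h k x)) /\
    forall k, `|limn (fun k => complex.Im (h k x)) - complex.Im (h k x)| <=
      2 * Num.sqrt (fine (S x)) * 2^-1 ^+ k.
  apply: (@geometric_cauchy R (fun k => complex.Im (h k x))) => k j.
  by rewrite ImB (le_trans (norm_Im_le _)).
pose g x : R[i]^o := Complex (limn (fun k => complex.Re (h k x)))
                             (limn (fun k => complex.Im (h k x))).
have mg1 : measurable_fun setT (fun x => complex.Re (g x)).
  apply: (@measurable_fun_cvg _ _ _ _ (fun k x => complex.Re (h k x))).
    move=> k; rewrite /h; under eq_fun do rewrite (fun_if (@complex.Re R)).
    have [fr _ _] := L2funP (f k).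
    by apply: measurable_fun_ifT.
  by move=> x _; have [] := hRe x.
have mg2 : measurable_fun setT (fun x => complex.Im (g x)).
  apply: (@measurable_fun_cvg _ _ _ _ (fun k x => complex.Im (h k x))).
    move=> k; rewrite /h; under eq_fun do rewrite (fun_if (@complex.Im R)).
    have [_ fi _] := L2funP (f k).
    by apply: measurable_fun_ifT.
  by move=> x _; have [] := hIm x.
have gf k x : E x -> ((normc (g x - f k x) ^+ 2)%:E <= (8 * 4 ^- k)%:E * S x)%E.
  move=> Ex; have SE : S x = (fine (S x))%:E by rewrite fineK// ge0_fin_numE.
  set s := fine (S x) in SE *; rewrite SE -EFinM lee_fin.
  have s0 : 0 <= s by rewrite -lee_fin -SE.
  have B0 : 0 <= 2 * Num.sqrt s * 2^-1 ^+ k.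
    by rewrite mulr_ge0 ?mulr_ge0 ?sqrtr_ge0 ?exprn_ge0 ?invr_ge0.
  have B2 : (2 * Num.sqrt s * 2^-1 ^+ k) ^+ 2 *+ 2 = 8 * 4 ^- k * s.
    have q : (2^-1 ^+ k) ^+ 2 = 4 ^- k :> R.
      by rewrite -exprM mulnC exprM exprVn exprVn -natrX.
    by rewrite !exprMn sqr_sqrtr// q; ring.
  have hE : h k x = f k x by rewrite /h Ex.
  have sq_le (a : R) : `|a| <= 2 * Num.sqrt s * 2^-1 ^+ k ->
      a ^+ 2 <= (2 * Num.sqrt s * 2^-1 ^+ k) ^+ 2.
    by move=> aB; rewrite -real_normK ?num_real// ler_pXn2r ?nnegrE.
  rewrite normc_sqrE -ReB -ImB -B2 mulr2n lerD// sq_le// -hE.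
    by have [_ ->] := hRe x.
  by have [_ ->] := hIm x.
have mgf k : measurable_fun setT (fun x => (normc (g x - f k x) ^+ 2)%:E).
  have [fr fi _] := L2funP (f k).
  apply/measurable_EFinP; apply: measurable_normc2.
    by under eq_fun do rewrite -ReB; exact: measurable_funB.
  by under eq_fun do rewrite -ImB; exact: measurable_funB.
have int_gf k : (\int[mu]_x (normc (g x - f k x) ^+ 2)%:E <= (8 * 4 ^- k)%:E)%E.
  have c0 : 0 <= 8 * 4 ^- k :> R by rewrite mulr_ge0 ?invr_ge0 ?exprn_ge0.
  apply: (@le_trans _ _ (\int[mu]_x ((8 * 4 ^- k)%:E * S x))%E).
    apply: ae_ge0_le_integral => //.
    - by move=> x _; rewrite lee_fin sqr_ge0.
    - by move=> x _; rewrite mule_ge0.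
    - exact: measurable_funeM.
    - by apply: filterS aeE => x Ex _; exact: gf.
  rewrite ge0_integralZl_EFin//.
  by rewrite -[leRHS]mule1; apply: lee_wpmul2l intS; rewrite lee_fin.
have e2 : ((fun x => g x - f 0%N x) : T -> R[i]^o) \in square_integrable_pred mu.
  have [fr fi _] := L2funP (f 0%N).
  apply/asboolP; split.
  - by under eq_fun do rewrite -ReB; exact: measurable_funB.
  - by under eq_fun do rewrite -ImB; exact: measurable_funB.
  - by apply: le_lt_trans (int_gf 0%N) _; rewrite ltry.
exists (L2Fun e2 + f 0%N) => k; rewrite L2_norm_sqr_le; last first.
  by rewrite mulr_ge0 ?invr_ge0 ?exprn_ge0.
rewrite (eq_integral (fun x => (normc (g x - f k x) ^+ 2)%:E)); first exact: int_gf.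
move=> x _; congr (normc _ ^+ 2)%:E.
by rewrite -[LHS]/(g x - f 0%N x + f 0%N x - f k x) subrK.
Qed.

Lemma L2classB (f g : L2fun mu) : L2class (f - g) = L2class f - L2class g.
Proof.
by rewrite addrC -(scaleN1r g) L2class_linear scaleN1r addrC.
Qed.

Lemma ler_sqr_real (V : normedModType R[i]) (x : V) (c : R) : 0 <= c ->
  (`|x| ^+ 2 <= (c ^+ 2)%:C%C) = (`|x| <= c%:C%C).
Proof. by move=> c0; rewrite rmorphXn ler_pXn2r ?nnegrE// ler0c. Qed.

Lemma pow4_le_pow2 k : 4 ^- k <= 2 ^- k :> R.
Proof. by rewrite lef_pV2 ?posrE ?exprn_gt0// lerXn2r ?nnegrE// ler_nat. Qed.

Lemma sqr_pow4_le k : (2 * (4 ^- k / 4)) ^+ 2 <= 8 ^- k / 2 :> R.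
Proof.
have -> : 8 ^- k = 4 ^- k * 2 ^- k :> R by rewrite -invfM -exprMn -natrM.
have x0 : 0 <= 4 ^- k :> R by rewrite invr_ge0 exprn_ge0.
have := ler_wpM2l x0 (pow4_le_pow2 k).
move: (mulr_ge0 x0 x0); move: (4 ^- k) (2 ^- k) => x z; rewrite expr2.
by lra.
Qed.

(** Centres of balls of radius [4^-k / 4] belonging to the filter form a
    sequence to which the previous lemma applies: consecutive balls meet, so the
    squared distance of their centres is at most [16^-k / 4]. *)
Lemma L2_complete (F : set_system (L2 mu)) : ProperFilter F -> cauchy F -> cvg F.
Proof.
move=> FF /cauchyP Fc.
pose eps k : R := 4 ^- k / 4.
have eps0 k : 0 < eps k by rewrite divr_gt0// invr_gt0 exprn_gt0.
have /choice[a aP] : forall k, exists a : L2 mu, F (ball a (eps k)%:C%C).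
  by move=> k; apply: Fc; rewrite ltcR.
have fast k : `|L2class (L2_repr (a k.+1) - L2_repr (a k))| ^+ 2 <= (8 ^- k / 2)%:C%C.
  have [y []] := filter_ex (filterI (aP k) (aP k.+1)).
  rewrite -!ball_normE /= => ya yb.
  rewrite L2classB !L2reprK (@le_trans _ _ (((2 * eps k) ^+ 2)%:C%C))//.
    rewrite ler_sqr_real ?mulr_ge0 ?(ltW (eps0 _))//.
    rewrite -(subrKA y) (le_trans (ler_normD _ _))//.
    rewrite mulrDl mul1r rmorphD lerD//; last by rewrite distrC ltW.
    rewrite (le_trans (ltW yb))// lecR /eps ler_pM2r ?invr_gt0//.
    by rewrite exprS invfM ler_piMl ?invr_ge0 ?exprn_ge0// invf_le1// ler1n.
  by rewrite lecR; exact: sqr_pow4_le.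
have [g gP] := @L2_fast_cauchy_cvg (fun k => L2_repr (a k)) fast.
have ga k : `|L2class g - a k| <= (3 * 2^-1 ^+ k)%:C%C.
  rewrite -ler_sqr_real ?mulr_ge0 ?exprn_ge0 ?invr_ge0//.
  rewrite -{1}[a k]L2reprK -L2classB (le_trans (gP k))// lecR exprMn.
  rewrite -exprM mulnC exprM exprVn exprVn -!natrX.
  by rewrite ler_pM2r ?invr_gt0 ?exprn_gt0// ler_nat.
apply: (cvgP (L2class g)); apply/cvgrPdist_lt => e e0.
have eE : e = (complex.Re e)%:C%C by rewrite RRe_real// gtr0_real.
have e1 : 0 < complex.Re e by rewrite -ltcR -eE.
have /cvgrPdist_lt/(_ _ e1)[N _ /(_ N (leqnn N))/=] := cvg_half (4 : R).
rewrite sub0r normrN => N_small.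
apply: filterS (aP N) => y; rewrite -ball_normE /= => ya.
rewrite -(subrKA (a N)) (le_lt_trans (ler_normD _ _))//.
rewrite (lt_le_trans (ler_ltD (ga N) ya))// -rmorphD eE lecR.
rewrite (le_trans _ (ltW N_small))// (le_trans _ (ler_norm _))//.
have -> : 4 * 2^-1 ^+ N = 3 * 2^-1 ^+ N + 2^-1 ^+ N :> R by ring.
rewrite lerD2l /eps exprVn.
have := pow4_le_pow2 N; have : 0 <= 4 ^- N :> R by rewrite invr_ge0 exprn_ge0.
move: (4 ^- N) (2 ^- N) => x z; clear; lra.
Qed.

HB.instance Definition _ := Uniform_isComplete.Build (L2 mu) L2_complete.

End RieszFischer.

HB.instance Definition _ (R : realType) := Complete.on (L2_01 R).

(** * The odometer equation for pure isometries *)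

Section HilbertLimits.
Context {R : realType}.

Lemma squeeze_cvg0 (V : normedModType R[i]) (f : nat -> V) (g : nat -> R[i]^o) :
  (forall n, `|f n| <= g n) -> g n @[n --> \oo] --> (0 : R[i]^o) ->
  f n @[n --> \oo] --> (0 : V).
Proof.
move=> fg /cvgr0Pnorm_lt g0; apply/cvgr0Pnorm_lt => e e0.
near=> n; rewrite (le_lt_trans (fg n))// (le_lt_trans (real_ler_norm _))//.
  by rewrite ger0_real// (le_trans _ (fg n)).
by near: n; exact: g0.
Unshelve. all: by end_near. Qed.

Lemma innerBl (H : preHilbertType R) (x y z : H) :
  inner (x - y) z = inner x z - inner y z.
Proof. by rewrite innerDl -scaleN1r innerZl mulN1r. Qed.

Lemma innerBr (H : preHilbertType R) (x y z : H) :
  inner z (x - y) = inner z x - inner z y.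
Proof. by rewrite innerC innerBl rmorphB/= -!innerC. Qed.

Lemma cvg_inner (H : preHilbertType R) (x y : nat -> H) (a b : H) :
  x n @[n --> \oo] --> a -> y n @[n --> \oo] --> b ->
  (inner (x n) (y n) : R[i]^o) @[n --> \oo] --> (inner a b : R[i]^o).
Proof.
move=> xa yb.
have xa0 : `|x n - a| @[n --> \oo] --> (0 : R[i]^o).
  by apply/norm_cvg0P; rewrite -(subrr a); apply: cvgB => //; exact: cvg_cst.
have yb0 : `|y n - b| @[n --> \oo] --> (0 : R[i]^o).
  by apply/norm_cvg0P; rewrite -(subrr b); apply: cvgB => //; exact: cvg_cst.
apply: cvg_sub0.
  apply: (@squeeze_cvg0 _ _ (fun n => `|x n - a| * `|y n - b| +
      (`|x n - a| * `|b| + `|a| * `|y n - b|))).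
    move=> n /=.
    have E : inner (x n) (y n) - inner a b = inner (x n - a) (y n - b) +
        (inner (x n - a) b + inner a (y n - b)).
      by rewrite !innerBl !innerBr; ring.
    rewrite [X in `|X| <= _]E (le_trans (ler_normD _ _))// lerD ?ler_norm_inner//.
    by rewrite (le_trans (ler_normD _ _))// lerD ?ler_norm_inner.
  rewrite -(_ : 0 * 0 + (0 * `|b| + `|a| * 0) = 0 :> R[i]^o); last first.
    by rewrite !(mul0r, mulr0) !addr0.
  apply: cvgD; last apply: cvgD.
  - apply: cvgM. exact: xa0. exact: yb0.
  - apply: cvgM. exact: xa0. exact: cvg_cst.
  - apply: cvgM. exact: cvg_cst. exact: yb0.
exact: cvg_cst.
Qed.

Lemma inner_cvg_unique (H : preHilbertType R) (x y : nat -> H) (a b : H) (c : R[i]) :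
  x n @[n --> \oo] --> a -> y n @[n --> \oo] --> b ->
  (inner (x n) (y n) : R[i]^o) @[n --> \oo] --> (c : R[i]^o) -> inner a b = c.
Proof. by move=> xa yb; apply: cvg_unique; [exact: norm_hausdorff|exact: cvg_inner]. Qed.

End HilbertLimits.

Section Isometries.
Context {R : realType} {H : nzPreHilbertType R}.
Implicit Types (V W : bounded_operator H) (x y : H).

Lemma boundedB V W x : (V - W) x = V x - W x.
Proof. by []. Qed.

Lemma boundedM V W x : (V * W) x = V (W x).
Proof. by []. Qed.

Lemma bounded_linear0 V : V 0 = 0.
Proof.
have := bounded_operator_linear V (-1) 0 0.
by rewrite !scaleN1r oppr0 add0r addNr.
Qed.

Lemma bounded_linearB V x y : V (x - y) = V x - V y.
Proof.
by rewrite addrC -scaleN1r bounded_operator_linear scaleN1r addrC.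
Qed.

Lemma bounded_cvg V (x : nat -> H) (a : H) :
  x n @[n --> \oo] --> a -> V (x n) @[n --> \oo] --> V a.
Proof.
move=> xa; have [_ [M VM] _] := bounded_operator_bounded V.
apply: cvg_sub0; last exact: cvg_cst.
apply: (@squeeze_cvg0 _ _ _ (fun n => M * `|x n - a|)).
  by move=> n /=; rewrite -bounded_linearB.
rewrite -(mulr0 M); apply: cvgM; first exact: cvg_cst.
by apply/norm_cvg0P; rewrite -(subrr a); apply: cvgB => //; exact: cvg_cst.
Qed.

Lemma norm_isometry V x : star V * V = 1 -> `|V x| = `|x|.
Proof.
move=> V1; apply/eqP; rewrite -(eqrXn2 (n := 2))// -!inner_normE.
by rewrite bounded_operator_starP -boundedM V1.
Qed.

End Isometries.

Section OdometerEquation.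
Context {R : realType} {H : hilbertType R}.
Implicit Types (B P Q : bounded_operator H).

(** The partial sums of the series with general term [P^k B (star Q)^k]. *)
Definition odometer_approx B P Q n : bounded_operator H :=
  iter n (fun X => B + P * X * star Q) 0.

Lemma odometer_approx_star B P Q n :
  star (odometer_approx B P Q n) = odometer_approx (star B) Q P n.
Proof.
elim: n => [|n IHn] /=; first exact: star0.
by rewrite starD !starM starK IHn mulrA.
Qed.

(** The partial sums are partial isometries whose initial space is the
    orthogonal complement of the range of [Q^n]. *)
Lemma odometer_approx_gram B P Q n :
  star P * P = 1 -> star B * P = 0 -> star B * B = 1 - Q * star Q ->
  star (odometer_approx B P Q n) * odometer_approx B P Q n =
  1 - Q ^+ n * star (Q ^+ n).
Proof.
move=> P1 BP BB; have PB : star P * B = 0.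
  by rewrite -[LHS]starK starM starK BP star0.
elim: n => [|n IHn] /=.
  by rewrite mulr0 expr0 star1 mulr1 subrr.
set X := odometer_approx B P Q n in IHn *.
rewrite starD !starM starK mulrDl !mulrDr BB.
have -> : star B * (P * X * star Q) = 0 by rewrite -(mulrA P) (mulrA (star B)) BP mul0r.
have -> : Q * (star X * star P) * B = 0 by rewrite -!mulrA PB !mulr0.
have -> : Q * (star X * star P) * (P * X * star Q) =
    Q * (1 - Q ^+ n * star (Q ^+ n)) * star Q.
  by rewrite -IHn !mulrA -(mulrA _ (star P) P) P1 mulr1.
by rewrite addr0 add0r mulrBr mulrBl mulr1 addrA subrK exprS starM !mulrA.
Qed.

Lemma odometer_approx_tail B P Q n k :
  odometer_approx B P Q (n + k) - odometer_approx B P Q n =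
  P ^+ n * odometer_approx B P Q k * star (Q ^+ n).
Proof.
elim: n => [|n IHn]; first by rewrite expr0 star1 mul1r mulr1 subr0.
rewrite addSn /= opprD addrACA subrr add0r -mulrBl -mulrBr IHn.
by rewrite !exprS starM !mulrA.
Qed.

(** The series does not converge in norm, but all increments at [x] after rank
    [n] are bounded by the component of [x] in the range of [Q^n], because the
    partial sums are contractions; purity of [Q] makes this bound tend to 0. *)
Lemma odometer_approx_cvg B P Q x :
  star P * P = 1 -> star B * P = 0 -> star B * B = 1 - Q * star Q ->
  pure_isometry Q -> cvg (odometer_approx B P Q n x @[n --> \oo]).
Proof.
move=> P1 BP BB [Q1 Q0].
suff tail n k : `|odometer_approx B P Q (n + k) x - odometer_approx B P Q n x| <=
    `|(Q ^+ n * star (Q ^+ n)) x|.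
  exact: (@cauchy_tail_cvg _ H H (fun n => odometer_approx B P Q n x)
    (fun n => (Q ^+ n * star (Q ^+ n)) x) tail (Q0 x)).
rewrite -boundedB odometer_approx_tail -mulrA !boundedM.
have iso (W : bounded_operator H) m z : star W * W = 1 -> `|(W ^+ m) z| = `|z|.
  by move=> W1; apply: norm_isometry; rewrite starX isometryX.
rewrite !iso// -(ler_pXn2r (n := 2))// ?nnegrE// -!inner_normE.
rewrite bounded_operator_starP -boundedM odometer_approx_gram//.
rewrite boundedB innerBr gerBl boundedM.
by rewrite -{1}(starK (Q ^+ k)) -bounded_operator_starP inner_normE exprn_ge0.
Qed.

Lemma odometer_limit_inner B P Q (U : H -> H) x y :
  star P * P = 1 -> star B * P = 0 -> star B * B = 1 - Q * star Q ->
  pure_isometry Q ->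
  (forall z, odometer_approx B P Q n z @[n --> \oo] --> U z) ->
  inner (U x) (U y) = inner x y.
Proof.
move=> P1 BP BB [_ Q0] UP.
apply: (inner_cvg_unique (UP x) (UP y)).
rewrite [X in X @ _ --> _](_ : _ = fun n => inner x (y - (Q ^+ n * star (Q ^+ n)) y)).
  rewrite (_ : inner x y = inner x (y - 0)); last by rewrite subr0.
  apply: cvg_inner; first exact: cvg_cst.
  by apply: cvgB; [exact: cvg_cst|exact: Q0].
apply/funext => n; rewrite bounded_operator_starP -boundedM.
by rewrite odometer_approx_gram.
Qed.

(** The adjoints of the partial sums are the partial sums for [star B] with [P]
    and [Q] exchanged. Hence they converge strongly too, their limit is the
    adjoint of the limit [U], and both are isometric, so [U] is unitary. *)
Theorem odometer_equation B P Q :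
  star B * P = 0 -> B * Q = 0 ->
  star B * B = 1 - Q * star Q -> B * star B = 1 - P * star P ->
  pure_isometry P -> pure_isometry Q ->
  exists U, [/\ star U * U = 1, U * star U = 1 & U = B + P * U * star Q].
Proof.
move=> BP BQ BB BBs Ppure Qpure; have [P1 _] := Ppure; have [Q1 _] := Qpure.
have BQs : star (star B) * Q = 0 by rewrite starK.
have BBs' : star (star B) * star B = 1 - P * star P by rewrite starK.
pose U x : H := lim (odometer_approx B P Q n x @[n --> \oo]).
pose V x : H := lim (odometer_approx (star B) Q P n x @[n --> \oo]).
have UP x : odometer_approx B P Q n x @[n --> \oo] --> U x.
  exact: odometer_approx_cvg.
have VP x : odometer_approx (star B) Q P n x @[n --> \oo] --> V x.
  exact: odometer_approx_cvg.
have UV : adjoint_pair U V.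
  move=> x y; apply: (inner_cvg_unique (UP x) (cvg_cst y)).
  under eq_fun do rewrite bounded_operator_starP odometer_approx_star.
  by apply: cvg_inner; [exact: cvg_cst|exact: VP].
have UI x y : inner (U x) (U y) = inner x y.
  exact: odometer_limit_inner UP.
have VI x y : inner (V x) (V y) = inner x y.
  exact: odometer_limit_inner VP.
have Ub : U \in bounded_op_pred.
  apply/asboolP; split.
  - move=> a x y; apply: inner_extl => z.
    by rewrite innerDl innerZl !UV innerDl innerZl.
  - exists 1 => x; rewrite mul1r -(ler_pXn2r (n := 2))// ?nnegrE//.
    by rewrite -!inner_normE UI.
  - by exists V.
pose u := BoundedOperator Ub; exists u.
have uV x : star u x = V x.
  by apply: inner_extr => z; rewrite -bounded_operator_starP UV.
split.
- apply: bounded_operatorP => x; apply: inner_extr => z.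
  by rewrite boundedM -bounded_operator_starP UI.
- apply: bounded_operatorP => x; apply: inner_extr => z.
  by rewrite boundedM -{1}(starK u) -bounded_operator_starP !uV VI.
- apply: bounded_operatorP => x.
  have UPS : odometer_approx B P Q n.+1 x @[n --> \oo] --> U x.
    by rewrite (cvg_shiftS (fun n => odometer_approx B P Q n x)); exact: UP.
  apply: cvg_unique UPS _; first exact: norm_hausdorff.
  apply: cvgD; first exact: cvg_cst.
  by apply: bounded_cvg; exact: UP.
Qed.

End OdometerEquation.

(** The difference [D] of two solutions satisfies [D = P D (star Q)], hence
    [D Q^n = P^n D] and [D = D Q^n star (Q^n)], which tends strongly to 0. *)
Lemma odometer_equation_unique (R : realType) (H : nzPreHilbertType R)
    (B P Q U V : bounded_operator H) : pure_isometry Q ->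
  U = B + P * U * star Q -> V = B + P * V * star Q -> U = V.
Proof.
move=> [Q1 Q0] UE VE; pose D := U - V.
have DE : D = P * D * star Q.
  by rewrite /D {1}UE {1}VE opprD addrACA subrr add0r mulrBr mulrBl.
have DQ : D * Q = P * D by rewrite {1}DE -mulrA Q1 mulr1.
have DQn n : D * Q ^+ n = P ^+ n * D.
  elim: n => [|n IHn]; first by rewrite !expr0 mulr1 mul1r.
  by rewrite exprSr mulrA IHn -mulrA DQ mulrA -exprSr.
have DPn n : D = D * (Q ^+ n * star (Q ^+ n)).
  rewrite mulrA DQn; elim: n => [|n IHn]; first by rewrite !expr0 star1 mulr1 mul1r.
  by rewrite {1}DE {1}IHn !exprS starM !mulrA.
apply/eqP; rewrite -subr_eq0; apply/eqP/bounded_operatorP => x; rewrite -/D.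
rewrite -[RHS](bounded_linear0 D).
have := bounded_cvg (V := D) (Q0 x); under eq_fun do rewrite -boundedM -DPn.
by move=> Dx; apply: cvg_unique (cvg_cst (D x)) Dx; exact: norm_hausdorff.
Qed.

(** A fixed vector belongs to the range of every power of [v]. *)
Lemma pure_isometry_fixed0 (R : realType) (H : nzPreHilbertType R)
    (v : bounded_operator H) (x : H) : pure_isometry v -> v x = x -> x = 0.
Proof.
move=> [v1 v0] vx.
have vnx n : (v ^+ n) x = x by elim: n => [//|n IHn]; rewrite exprS boundedM IHn.
have svnx n : star (v ^+ n) x = x.
  by rewrite -{1}(vnx n) -boundedM starX isometryX.
have := v0 x; under eq_fun do rewrite boundedM svnx vnx.
by move=> x0; apply: cvg_unique (cvg_cst x) x0; exact: norm_hausdorff.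
Qed.

(** * Affine changes of variable on the unit interval *)

Section AffineNullSets.
Context {R : realType}.

(** The pushforward of the measure along [t |-> a * t - b], scaled by [a], has
    the same values on intervals, hence is the same measure. *)
Lemma lebesgue_affine_preimage (a b : R) (A : set (measurableTypeR R)) :
  0 < a -> measurable A ->
  lebesgue_measure ((fun t : R => a * t - b) @^-1` A) =
    (a^-1%:E * lebesgue_measure A)%E.
Proof.
move=> a0 mA.
pose h : measurableTypeR R -> measurableTypeR R := fun t => a * t - b.
have mh : measurable_fun setT h.
  by apply: measurable_funB; [exact: measurable_funM|exact: measurable_cst].
pose nu0 : {measure set (measurableTypeR R) -> \bar R} :=
  measure_function_pushforward__canonical__measure_function_Measure lebesgue_measure mh.
pose nu : {measure set (measurableTypeR R) -> \bar R} := mscale (NngNum (ltW a0)) nu0.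
have nuE : lebesgue_measure A = nu A.
  apply: lebesgue_measure_unique => // X [[x y] _ <-] /=.
  rewrite /nu /mscale /= /pushforward.
  have -> : h @^-1` `]x, y] = `](x + b) / a, (y + b) / a]%classic.
    apply/seteqP; split=> t /=; rewrite !in_itv/= => /andP[xt ty]; apply/andP; split.
    - by rewrite ltr_pdivrMr// -ltrBrDr mulrC.
    - by rewrite ler_pdivlMr// -lerBlDr mulrC.
    - by rewrite /h ltrBrDr mulrC -ltr_pdivrMr.
    - by rewrite /h lerBlDr mulrC -ler_pdivlMr.
  rewrite !lebesgue_measure_itv /= !lte_fin ltr_pM2r ?invr_gt0// ltrD2r.
  case: ifPn => _; last by rewrite mule0.
  by rewrite -!EFinD -EFinM; congr EFin; field; rewrite gt_eqF.
rewrite nuE /nu /mscale /= muleA -EFinM mulVf ?gt_eqF// mul1e.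
by [].
Qed.

(** A representative of a class in [L2_01 R] is known almost everywhere only;
    this is what allows to compose it with the inverse of [t |-> (i + t) / p]. *)
Lemma ae_affine_pullback (p i : nat) (P : R -> Prop) : (0 < p)%N ->
  {ae lebesgue01 R, forall t, P t} ->
  {ae lebesgue01 R, forall t : R,
    t \in `[i%:R / p%:R, i.+1%:R / p%:R] -> P (p%:R * t - i%:R)}.
Proof.
move=> p0 [N [mN N0 subN]].
have pr0 : 0 < p%:R :> R by rewrite ltr0n.
pose h (t : R) := p%:R * t - i%:R.
have mN01 : measurable (N `&` `[0%R, 1%R]%classic) by exact: measurableI.
have mh : measurable_fun setT (h : measurableTypeR R -> measurableTypeR R).
  by apply: measurable_funB; [exact: measurable_funM|exact: measurable_cst].
have mM : measurable (h @^-1` (N `&` `[0%R, 1%R]%classic)).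
  by rewrite -[X in measurable X]setTI; exact: mh.
exists (h @^-1` (N `&` `[0%R, 1%R]%classic)); split => //.
  apply/eqP; rewrite eq_le measure_ge0 andbT.
  rewrite /lebesgue01 /= /mrestr.
  apply: (@le_trans _ _ (lebesgue_measure (h @^-1` (N `&` `[0%R, 1%R]%classic)))).
    by apply: le_measure; rewrite ?inE//; exact: measurableI.
  rewrite lebesgue_affine_preimage//.
  by move: N0; rewrite /lebesgue01 /= /mrestr => ->; rewrite mule0.
move=> t /= /not_implyP[]; rewrite in_itv/= => /andP[it ti] nP; split.
  exact: subN.
rewrite in_itv/= /h subr_ge0 mulrC -ler_pdivrMr// it/=.
by rewrite lerBlDr -ler_pdivlMr// nat1r.
Qed.

Lemma ae_lebesgue01_itv : {ae lebesgue01 R, forall t : R, t \in `[0, 1]}.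
Proof.
exists (~` `[0%R, 1%R]%classic); split => //.
- exact: measurableC.
- by rewrite /lebesgue01 /= /mrestr setICl measure0.
Qed.

Lemma ae_lebesgue01_neq (x : R) : {ae lebesgue01 R, forall t : R, t != x}.
Proof.
exists [set x]; split => //.
  apply/eqP; rewrite eq_le measure_ge0 andbT /lebesgue01 /= /mrestr.
  rewrite -(lebesgue_measure_set1 x) le_measure ?inE//; first exact: measurableI.
by move=> t /= /negP; rewrite negbK => /eqP.
Qed.

End AffineNullSets.

Instance ae_lebesgue01_filter (R : realType) :
  Filter (nbhs (almost_everywhere (lebesgue01 R))) :=
  ae_filter_ringOfSetsType (lebesgue01 R).

(** * Restriction of square integrable functions *)

Section Cutoff.
Context d {T : measurableType d} {R : realType}.
Variable mu : {measure set T -> \bar R}.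
Local Notation normc := Normc.normc.

Lemma normc2_indic (A : set T) (z : R[i]) t :
  normc ((\1_A t)%:C%C * z) ^+ 2 = \1_A t * normc z ^+ 2.
Proof.
rewrite indicE; case: (t \in A); first by rewrite !mul1r.
by rewrite !mul0r Normc.normc0 expr0n.
Qed.

Fact cutoff_subproof (A : set T) (f : L2fun mu) : measurable A ->
  ((fun t => (\1_A t)%:C%C * f t) : T -> R[i]^o) \in square_integrable_pred mu.
Proof.
move=> mA; have [fr fi f2] := L2funP f.
have RE t : complex.Re ((\1_A t)%:C%C * f t) = \1_A t * complex.Re (f t).
  by case: (f t) => a b /=; rewrite mul0r subr0.
have IE t : complex.Im ((\1_A t)%:C%C * f t) = \1_A t * complex.Im (f t).
  by case: (f t) => a b /=; rewrite mul0r addr0.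
have m1 : measurable_fun setT (fun t => complex.Re ((\1_A t)%:C%C * f t)).
  by under eq_fun do rewrite RE; apply: measurable_funM => //; exact: measurable_indic.
have m2 : measurable_fun setT (fun t => complex.Im ((\1_A t)%:C%C * f t)).
  by under eq_fun do rewrite IE; apply: measurable_funM => //; exact: measurable_indic.
apply/asboolP; split => //.
apply: le_lt_trans f2; apply: ge0_le_integral => //.
- by move=> t _; rewrite lee_fin sqr_ge0.
- by apply/measurable_EFinP; exact: measurable_normc2.
- exact: L2_measurable_normc2.
- by move=> t _; rewrite lee_fin normc2_indic ler_piMl ?sqr_ge0.
Qed.

Definition cutoff (A : set T) (mA : measurable A) (f : L2fun mu) : L2fun mu :=
  L2Fun (cutoff_subproof f mA).

Lemma inner_cutoff (A : set T) (mA : measurable A) (f g : L2fun mu) :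
  L2fun_inner (cutoff mA f) g = L2fun_inner f (cutoff mA g).
Proof.
by rewrite /L2fun_inner; congr Complex; apply: eq_Rintegral => t _ /=;
  case: (f t) (g t) => [a b] [c e] /=; ring.
Qed.

(** Dominated convergence, the squared modulus of [f] dominating those of its
    restrictions. *)
Lemma cutoff_cvg0 (A : nat -> set T) (mA : forall n, measurable (A n)) (f : L2fun mu) :
  {ae mu, forall t, \forall n \near \oo, ~ A n t} ->
  L2class (cutoff (mA n) f) @[n --> \oo] --> (0 : L2 mu).
Proof.
move=> A0.
have [_ _ f2] := L2funP f.
have fint : mu.-integrable setT (fun t => (normc (f t) ^+ 2)%:E).
  apply/integrableP; split; first exact: L2_measurable_normc2.
  by under eq_integral do rewrite gee0_abs ?lee_fin ?sqr_ge0//.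
have mcut n := L2_measurable_normc2 (cutoff (mA n) f).
have cut0 : {ae mu, forall t, setT t ->
    (normc (cutoff (mA n) f t) ^+ 2)%:E @[n --> \oo] --> (0 : \bar R)}.
  apply: filterS A0 => t A0 _; apply: cvg_near_cst.
  by apply: filterS A0 => n nA; rewrite normc2_indic indicE memNset// mul0r.
have cut_le : {ae mu, forall t n, setT t ->
    (`|(normc (cutoff (mA n) f t) ^+ 2)%:E| <= (normc (f t) ^+ 2)%:E)%E}.
  apply: aeW => t n _; rewrite gee0_abs ?lee_fin ?sqr_ge0//.
  by rewrite normc2_indic ler_piMl ?sqr_ge0.
have [_ _] := dominated_convergence measurableT mcut (measurable_cst _) cut0 fint cut_le.
rewrite integral0 => /fine_cvgP[_ /cvgrPdist_lt int0].
apply/cvgr0Pnorm_le => e e0.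
have eE : e = (complex.Re e)%:C%C by rewrite RRe_real// gtr0_real.
have e1 : 0 < complex.Re e by rewrite -ltcR -eE.
have := int0 (complex.Re e ^+ 2); rewrite exprn_gt0// => /(_ isT).
apply: filterS => n /=; rewrite sub0r normrN => int_lt.
rewrite eE -(ler_sqr_real _ (ltW e1)) L2_norm_sqrE lecR (le_trans (ler_norm _))//.
exact: ltW.
Qed.


End Cutoff.

(** * Purity of the interval picture *)

Section IntervalPicturePure.
Context {R : realType}.
Variables (p i : nat) (v : bounded_operator (L2_01 R)).
Hypotheses (p_ge2 : (2 <= p)%N) (lt_ip : (i < p)%N).
Hypothesis vP : interval_picture_op p i v.

(** The fixed point of [t |-> (i + t) / p]. *)
Let x0 : R := i%:R / (p%:R - 1).

Let P_gt1 : 1 < p%:R :> R. Proof. by rewrite ltr1n. Qed.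

Let P_gt0 : 0 < p%:R :> R. Proof. by rewrite (lt_trans _ P_gt1). Qed.

Let x0_itv : 0 <= x0 <= 1.
Proof.
have P1 : 0 < p%:R - 1 :> R by rewrite subr_gt0.
rewrite divr_ge0 ?(ltW P1)//= ler_pdivrMr// mul1r lerBrDr natr1 ler_nat.
by [].
Qed.

Let x0_fix (t : R) : p%:R * t - i%:R - x0 = p%:R * (t - x0).
Proof. by rewrite /x0; field; rewrite subr_eq0 gt_eqF. Qed.

(** It contains the image of [[0, 1]] under the [n]-th iterate of the
    contraction [t |-> (i + t) / p]. *)
Definition shrinking_itv n : set (measurableTypeR R) :=
  [set t : R | `|t - x0| <= p%:R ^- n].

Lemma measurable_shrinking_itv n : measurable (shrinking_itv n).
Proof.
rewrite (_ : shrinking_itv n = `[x0 - p%:R ^- n, x0 + p%:R ^- n]%classic)//.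
by apply/seteqP; split=> t; rewrite /shrinking_itv /= in_itv/= ler_distl.
Qed.

(** The value of [v g] at [t] is a multiple of that of [g] at [p t - i], which is
    [p] times as far from [x0] as [t] is. *)
Lemma interval_picture_support n (f : L2_01 R) :
  {ae lebesgue01 R, forall t : R, L2_repr ((v ^+ n) f) t != 0 -> shrinking_itv n t}.
Proof.
elim: n => [|n IHn].
  apply: filterS (@ae_lebesgue01_itv R) => t; rewrite in_itv/= => /andP[t0 t1] _.
  have /andP[y0 y1] := x0_itv.
  by rewrite /shrinking_itv /= expr0 invr1 ler_norml; apply/andP; split; lra.
rewrite exprS.
apply: filterS2 (vP ((v ^+ n) f)) (@ae_affine_pullback R p i _ (ltnW p_ge2) IHn).
move=> t vt; rewrite boundedM {}vt; case: ifPn => [ti|_]; last by rewrite eqxx.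
move=> /(_ isT) supp nz; have /supp : L2_repr ((v ^+ n) f) (p%:R * t - i%:R) != 0.
  by apply: contra_neq nz => ->; rewrite mulr0.
rewrite /shrinking_itv /= x0_fix normrM ger0_norm ?(ltW P_gt0)//.
by rewrite -ler_pdivlMl// -invfM -exprS.
Qed.

(** Let [y] be the projection of [x] on the range of [v^n]. As [y] is carried by
    [shrinking_itv n], the inner products of [y] with [x] and with the
    restriction of [x] to this interval agree, so that the norm of [y] is at most
    the norm of this restriction, which tends to 0. *)
Lemma interval_picture_pure : star v * v = 1 -> pure_isometry v.
Proof.
move=> v1; split=> // x.
pose c n : L2_01 R := L2class (cutoff (measurable_shrinking_itv n) (L2_repr (x : L2_01 R))).
have c0 : c n @[n --> \oo] --> (0 : L2_01 R).
  apply: cutoff_cvg0; apply: filterS (ae_lebesgue01_neq x0) => t tx0.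
  have d0 : 0 < `|t - x0| by rewrite normr_gt0 subr_eq0.
  have /cvgr0Pnorm_lt/(_ _ d0) : p%:R ^-1 ^+ n @[n --> \oo] --> (0 : R).
    by apply: cvg_expr; rewrite ger0_norm ?invr_ge0 ?(ltW P_gt0)// invf_lt1.
  apply: filterS => n; rewrite ger0_norm ?exprn_ge0 ?invr_ge0 ?(ltW P_gt0)// exprVn.
  by rewrite /shrinking_itv /= ltNge => /negP.
apply: squeeze_cvg0 (fun n => `|c n|) _ _; last exact/norm_cvg0P.
move=> n; pose y : L2_01 R := (v ^+ n * star (v ^+ n)) x.
rewrite -[X in `|X|]/y.
have [->|y0] := eqVneq y 0; first by rewrite normr0.
rewrite -(@ler_pM2l _ `|y|) ?normr_gt0// -expr2 -inner_normE.
have vn1 : star (v ^+ n) * v ^+ n = 1 by rewrite starX isometryX.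
have yE : y = L2class (cutoff (measurable_shrinking_itv n) (L2_repr y)).
  rewrite -[LHS]L2reprK; apply: L2class_eq.
  apply: filterS (interval_picture_support n (star (v ^+ n) x)) => t.
  rewrite -boundedM -/y /= indicE.
  have [->|y_neq0] := eqVneq (L2_repr y t) 0; first by rewrite mulr0.
  by move=> /(_ isT) At; rewrite mem_set// mul1r.
have yc : inner y y = inner y (c n).
  rewrite {1 2}/y boundedM bounded_operator_starP -boundedM vn1.
  rewrite -[LHS]bounded_operator_starP -boundedM -/y.
  rewrite {1}yE -[x in LHS]L2reprK [LHS]L2fun_inner_class inner_cutoff.
  by rewrite -{2}[y]L2reprK [RHS]L2fun_inner_class.
have y2 : 0 <= inner y y by rewrite inner_normE exprn_ge0.
by rewrite -(ger0_norm y2) yc ler_norm_inner.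
Qed.

End IntervalPicturePure.

(** * Cuntz families *)

Section CuntzFamilies.
Context {R : realType}.

Definition cuntz_family {A : starAlgType R} (p : nat) (T : nat -> A) : Prop :=
  (forall i, (i < p)%N -> star (T i) * T i = 1) /\
  \sum_(i < p) T i * star (T i) = 1.

(** In the interval picture with [p = q + 1], this is the translation by [1/p]
    of the functions carried by [[0, 1 - 1/p]]; in terms of the first digit in
    base [p], it is the addition of one when there is no carry. *)
Definition cuntz_shift {A : starAlgType R} (q : nat) (T : nat -> A) : A :=
  \sum_(i < q) T i.+1 * star (T i).

Lemma padic_cuntz_family (A : starAlgType R) p (u s : A) :
  padic_relations p u s -> cuntz_family p (cuntz_isometry u s).
Proof.
move=> [us1 us2 ss1 _ usum].
split=> [i _|].
  by rewrite /cuntz_isometry starM starX -mulrA (mulrA _ _ s) isometryX// mul1r.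
by rewrite -usum; apply: eq_bigr => i _; rewrite /cuntz_isometry starM starX !mulrA.
Qed.

(** On the range of [T i] with [i < q] the unitary [u] is the shift to the range
    of [T i.+1]; on the last range, [u * T q = u^(q + 1) * s = s * u]. The second
    summand is thus the addition of one with a carry. *)
Lemma padic_odometer (A : starAlgType R) q (u s : A) :
  padic_relations q.+1 u s ->
  let T := cuntz_isometry u s in
  u = cuntz_shift q T + T 0%N * u * star (T q).
Proof.
move=> rel T; have [_ T1] := padic_cuntz_family rel; have [_ _ _ su _] := rel.
rewrite -[LHS]mulr1 -T1 big_ord_recr /= mulrDr mulr_sumr; congr (_ + _).
  by apply: eq_bigr => i _; rewrite mulrA /cuntz_isometry mulrA -exprS.
rewrite mulrA; congr (_ * _).
by rewrite /T /cuntz_isometry expr0 mul1r su mulrA -exprS.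
Qed.

Context {H : nzPreHilbertType R}.
Implicit Types T : nat -> bounded_operator H.

Lemma sum_bounded_apply n (f : 'I_n -> bounded_operator H) x :
  (\sum_(i < n) f i) x = \sum_(i < n) f i x.
Proof. exact: (big_morph (fun g : bounded_operator H => g x)). Qed.

Lemma sum_inner n (y : 'I_n -> H) x :
  inner (\sum_(i < n) y i) x = \sum_(i < n) inner (y i) x.
Proof.
by apply: (big_morph (inner^~ x)) => [a b|]; [exact: innerDl|exact: inner0l].
Qed.

(** Evaluated at [T j x], whose norm is that of [x], the sum of the range
    projections is already exhausted by the one of index [j]. *)
Lemma cuntz_family_orthogonal p T i j : cuntz_family p T ->
  (i < p)%N -> (j < p)%N -> i != j -> star (T i) * T j = 0.
Proof.
move=> [T1 Tsum] ip jp ij; apply: bounded_operatorP => x; rewrite boundedM.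
set y := T j x.
have yy : inner y y = \sum_(k < p) `|star (T k) y| ^+ 2.
  rewrite -{1}[y]/((1 : bounded_operator H) y) -Tsum sum_bounded_apply sum_inner.
  by apply: eq_bigr => k _; rewrite boundedM bounded_operator_starP inner_normE.
have : inner y y = `|star (T j) y| ^+ 2.
  by rewrite inner_normE /y -boundedM T1// (norm_isometry _ (T1 _ jp)).
rewrite {}yy (bigD1 (Ordinal jp))//= => /eqP.
rewrite -[eqbRHS]addr0 (inj_eq (addrI _)) psumr_eq0; last first.
  by move=> k _; rewrite exprn_ge0.
move/allP => /(_ (Ordinal ip)); rewrite mem_index_enum => /(_ isT) /implyP.
rewrite -val_eqE /= => /(_ ij).
by rewrite sqrf_eq0 normr_eq0 => /eqP.
Qed.

Lemma cuntz_family_shift q T : cuntz_family q.+1 T ->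
  let B := cuntz_shift q T in
  [/\ star B * T 0%N = 0, B * T q = 0,
      star B * B = 1 - T q * star (T q) & B * star B = 1 - T 0%N * star (T 0%N)].
Proof.
move=> Tfam B; have [T1 Tsum] := Tfam.
have orth i j : (i < q.+1)%N -> (j < q.+1)%N -> star (T i) * T j = (i == j)%:R.
  have [->|ij] := eqVneq i j; first by move=> _ /T1.
  by move=> ip jp; rewrite (cuntz_family_orthogonal Tfam).
have BE : star B = \sum_(i < q) T i * star (T i.+1).
  by rewrite star_sum; apply: eq_bigr => i _; rewrite starM starK.
have mid (a b c d : bounded_operator H) : a * b * (c * d) = a * (b * c) * d.
  by rewrite !mulrA.
split.
- rewrite BE mulr_suml big1// => i _.
  by rewrite -mulrA orth// ?mulr0// ltnS.
- rewrite mulr_suml big1// => i _.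
  by rewrite -mulrA (orth _ _ (leqW (ltn_ord i)) (ltnSn q)) ltn_eqF// mulr0.
- rewrite -Tsum big_ord_recr /= addrK BE mulr_suml; apply: eq_bigr => i _.
  rewrite mulr_sumr (bigD1 i)//= mid orth ?ltnS// eqxx mulr1 big1 ?addr0// => j ji.
  by rewrite mid orth ?ltnS// eqSS eq_sym (inj_eq (@ord_inj _)) (negPf ji) mulr0 mul0r.
- rewrite -Tsum big_ord_recl /= addrC addKr BE mulr_suml; apply: eq_bigr => i _.
  rewrite mulr_sumr (bigD1 i)//= mid orth ?leqW// eqxx mulr1 big1 ?addr0// => j ji.
  by rewrite mid orth ?leqW// eq_sym (inj_eq (@ord_inj _)) (negPf ji) mulr0 mul0r.
Qed.

End CuntzFamilies.

(** * Extension of the interval picture *)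

Lemma ell2_delta_neq0 (R : realType) (m : int) : ell2_delta R m != 0.
Proof.
apply/eqP => /L2class_eq0 [N [_ N0 subN]].
have mN : [set m] `<=` N.
  by move=> _ ->; apply: subN => /=; rewrite eqxx; apply/eqP; rewrite oner_eq0.
have : (@counting int R [set m] <= @counting int R N)%E by rewrite le_measure ?inE.
rewrite [X in (_ <= X)%E]N0 /counting (asboolT (finite_set1 m)) fset_set1 finmap.cardfs1.
by rewrite lee_fin ler10.
Qed.

Section CuntzSubalgebra.
Context {R : realType} {A : cstarAlgType R} {H : nzPreHilbertType R}.
Variables (q : nat) (u s : A).
Hypothesis rel : padic_relations q.+1 u s.
Local Notation T := (cuntz_isometry u s).
Local Notation D := (cuntz_subalgebra q.+1 u s).

Lemma cuntz_subalgebra_isometry i : (i < q.+1)%N -> D (T i).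
Proof. by move=> iq E [_]; apply; exists i. Qed.

Lemma cuntz_subalgebra_sum n (a : 'I_n -> A) :
  (forall i, D (a i)) -> D (\sum_(i < n) a i).
Proof.
have [DD DZ _ _ _] := smallest_cstar_subalgebra [set T i | i in `I_q.+1].
move=> Da; apply: (big_ind D).
- rewrite -(scale0r (T 0)); apply: DZ.
  exact: (@cuntz_subalgebra_isometry 0).
- by move=> b c Db Dc; exact: DD.
- by move=> i _; exact: Da.
Qed.

Lemma cuntz_subalgebra1 : D 1.
Proof.
have [_ _ DM DS _] := smallest_cstar_subalgebra [set T i | i in `I_q.+1].
have [_ <-] := padic_cuntz_family rel; apply: cuntz_subalgebra_sum => i.
have DT := cuntz_subalgebra_isometry (ltn_ord i).
exact: DM DT (DS _ DT).
Qed.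

Lemma star_hom_on_sum (f : A -> bounded_operator H) n (a : 'I_n -> A) :
  star_hom_on D f -> (forall i, D (a i)) ->
  f (\sum_(i < n) a i) = \sum_(i < n) f (a i).
Proof.
move=> [_ fD fZ _ _]; elim: n a => [|n IHn] a Da.
  rewrite !big_ord0 -(scale0r (T 0)) fZ ?scale0r//.
  exact: cuntz_subalgebra_isometry.
rewrite !big_ord_recr /= fD ?IHn//; exact: cuntz_subalgebra_sum.
Qed.

Lemma star_hom_on_cuntz_family (f : A -> bounded_operator H) :
  star_hom_on D f -> cuntz_family q.+1 (fun i => f (T i)).
Proof.
move=> fhom; have [f1 _ _ fM fS] := fhom.
have [_ _ DM DS _] := smallest_cstar_subalgebra [set T i | i in `I_q.+1].
have DT := cuntz_subalgebra_isometry.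
have [T1 Tsum] := padic_cuntz_family rel.
split=> [i iq|].
  rewrite -fS; last exact: DT.
  by rewrite -fM ?T1//; [exact: DS (DT _ iq)|exact: DT].
rewrite -f1 -Tsum star_hom_on_sum//; last first.
  by move=> i; exact: DM (DT _ (ltn_ord i)) (DS _ (DT _ (ltn_ord i))).
apply: eq_bigr => i _; rewrite -fS; last exact: DT.
by rewrite fM//; [exact: DT|exact: DS (DT _ (ltn_ord i))].
Qed.

End CuntzSubalgebra.

Lemma star_hom_on_setT (R : realType) (A B : starAlgType R) (D : set A) (f : A -> B) :
  star_hom_on setT f -> star_hom_on D f.
Proof.
by move=> [f1 fD fZ fM fS]; split=> // *; [exact: fD|exact: fZ|exact: fM|exact: fS].
Qed.

Lemma star_homX (R : realType) (A B : starAlgType R) (f : A -> B) a n :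
  star_hom_on setT f -> f (a ^+ n) = f a ^+ n.
Proof.
move=> [f1 _ _ fM _]; elim: n => [|n IHn]; first by rewrite !expr0.
by rewrite !exprS fM// IHn.
Qed.

(** A solution [U] of the odometer equation carries the range of [T i] onto the
    range of [T i.+1], so its powers recover every [T i] from [T 0]; on the last
    range it gives the commutation relation between [U] and [T 0]. *)
Lemma cuntz_extension (R : realType) (H : nzPreHilbertType R) q
    (T : nat -> bounded_operator H) (U : bounded_operator H) :
  cuntz_family q.+1 T -> star U * U = 1 -> U * star U = 1 ->
  U = cuntz_shift q T + T 0%N * U * star (T q) ->
  padic_relations q.+1 U (T 0%N) /\
  forall i, (i < q.+1)%N -> cuntz_isometry U (T 0%N) i = T i.
Proof.
move=> Tfam U1 U2 UE; have [T1 Tsum] := Tfam.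
have [_ Bq _ _] := cuntz_family_shift Tfam.
have UT i : (i < q)%N -> U * T i = T i.+1.
  move=> iq; have iqS : (i < q.+1)%N := leqW iq.
  rewrite UE mulrDl -[T 0%N * U * _ * _]mulrA.
  rewrite (cuntz_family_orthogonal Tfam (ltnSn q) iqS) ?gtn_eqF// mulr0 addr0.
  rewrite /cuntz_shift mulr_suml (bigD1 (Ordinal iq))//= -mulrA T1// mulr1.
  rewrite big1 ?addr0// => j ji; have jq : (j < q.+1)%N := leqW (ltn_ord j).
  by rewrite -mulrA (cuntz_family_orthogonal Tfam jq iqS) ?mulr0.
have Uq : U * T q = T 0%N * U by rewrite {1}UE mulrDl Bq add0r -mulrA T1// mulr1.
have UX i : (i < q.+1)%N -> cuntz_isometry U (T 0%N) i = T i.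
  elim: i => [_|i IHi iq]; first by rewrite /cuntz_isometry expr0 mul1r.
  by rewrite /cuntz_isometry exprS -mulrA -[_ * T 0%N]/(cuntz_isometry U (T 0%N) i)
    (IHi (ltnW iq)) UT.
split=> //; split=> //; first exact: T1.
  by rewrite exprS -mulrA -[_ * T 0%N]/(cuntz_isometry U (T 0%N) q) UX.
rewrite -Tsum; apply: eq_bigr => i _.
by rewrite -(UX _ (ltn_ord i)) /cuntz_isometry starM starX !mulrA.
Qed.

Theorem proposition5p2 (R : realType) (p : nat) (p_ge2 : (2 <= p)%N)
    (Qp : cstarAlgType R) (u s : Qp) (Qp_univ : padic_ring_algebra p u s)
    (sigma : Qp -> bounded_operator (L2_01 R))
    (sigmaP : interval_picture p u s sigma)
    (pi : Qp -> bounded_operator (ell2_int R))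
    (piP : canonical_representation p u s pi) :
  (forall i, (i < p)%N -> pure_isometry (sigma (cuntz_isometry u s i))) /\
  exists sigma' : Qp -> bounded_operator (L2_01 R),
    [/\ representation_on setT sigma',
        forall a, cuntz_subalgebra p u s a -> sigma' a = sigma a,
        forall rho : Qp -> bounded_operator (L2_01 R),
          representation_on setT rho ->
          (forall a, cuntz_subalgebra p u s a -> rho a = sigma a) ->
          rho =1 sigma' &
        ~ unitarily_equivalent sigma' pi].
Proof.
case: p p_ge2 Qp_univ sigmaP piP => // q p_ge2 Qp_univ sigmaP piP.
have [rel gen univ] := Qp_univ; have [sigma_hom sigma_pic] := sigmaP.
pose T := cuntz_isometry u s; pose S i := sigma (T i).
have DT i : (i < q.+1)%N -> cuntz_subalgebra q.+1 u s (T i).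
  exact: cuntz_subalgebra_isometry.
have Sfam : cuntz_family q.+1 S := star_hom_on_cuntz_family rel sigma_hom.
have Spure i : (i < q.+1)%N -> pure_isometry (S i).
  move=> iq; have [S1 _] := Sfam.
  exact: (interval_picture_pure p_ge2 iq (sigma_pic i iq) (S1 i iq)).
split; first exact: Spure.
have [BP BQ BB BBs] := cuntz_family_shift Sfam.
have [U [U1 U2 UE]] := @odometer_equation R (L2_01 R : hilbertType R)
  _ _ _ BP BQ BB BBs (Spure 0%N (ltn0Sn q)) (Spure q (ltnSn q)).
have [Urel UX] := cuntz_extension Sfam U1 U2 UE.
have [sigma' [sigma'_hom sigma'u sigma's]] := univ (L2_01 R : hilbertType R) U (S 0%N) Urel.
have s0 : s = T 0%N by rewrite /T /cuntz_isometry expr0 mul1r.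
have sigma'E a : cuntz_subalgebra q.+1 u s a -> sigma' a = sigma a.
  apply: star_hom_on_unique => //.
  - exact: cuntz_subalgebra1.
  - exact: star_hom_on_setT.
  - move=> _ [i iq <-]; have [_ _ _ sM _] := sigma'_hom.
    by rewrite /cuntz_isometry sM// star_homX// sigma'u sigma's; exact: UX.
exists sigma'; split=> //.
- move=> rho rho_hom rhoE a.
  have rhoU : rho u = U.
    apply: odometer_equation_unique (Spure q (ltnSn q)) _ UE.
    have [_ rD _ rM rS] := rho_hom.
    apply: etrans (congr1 rho (padic_odometer rel)) _.
    have rT i : (i < q.+1)%N -> rho (T i) = S i by move=> iq; exact: rhoE (DT i iq).
    rewrite rD//; congr (_ + _); last first.
      by rewrite (rM (T 0%N * u))// (rM (T 0%N))// rS// (rT 0%N (ltn0Sn q)) (rT q (ltnSn q)).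
    rewrite /cuntz_shift (@star_hom_on_sum _ _ _ q u s _ _ _
      (star_hom_on_setT _ rho_hom)); last first.

    have [_ _ DM DS _] := smallest_cstar_subalgebra [set T i | i in `I_q.+1].
      by move=> i; exact: DM (DT i.+1 (ltn_ord i)) (DS _ (DT i (leqW (ltn_ord i)))).
    apply: eq_bigr => i _; rewrite rM// rS//.
    by rewrite (rT i.+1 (ltn_ord i)) (rT i (leqW (ltn_ord i))).
  have Da : smallest cstar_subalgebra [set u; s] a by rewrite gen.
  apply: star_hom_on_unique Da; rewrite ?gen//.
  move=> b [->|->]; first by rewrite rhoU sigma'u.
  by rewrite s0 (rhoE _ (DT _ (ltn0Sn q))) sigma'E//; exact: DT.
- move=> [W [Wlin Wsurj Winner Wint]].
  have [_ _ pis] := piP.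
  have [x Wx] := Wsurj (ell2_delta R 0).
  have W0 y : W y = 0 -> y = 0.
    by move=> Wy; apply: inner_extl => z; rewrite -Winner Wy !inner0l.
  have fix_x : S 0%N x = x.
    apply/eqP; rewrite -subr_eq0; apply/eqP/W0.
    rewrite addrC -scaleN1r Wlin scaleN1r -sigma's Wint Wx pis mulr0.
    by rewrite addNr.
  have := ell2_delta_neq0 R 0.
  rewrite -Wx (pure_isometry_fixed0 (Spure 0%N (ltn0Sn q)) fix_x).
  have /= := Wlin (-1) 0 0; rewrite !scaleN1r oppr0 add0r addNr => ->.
  by rewrite eqxx.
Qed.
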